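(* Let $n\ge 1$, and let $\mathfrak G,\tilde{\mathfrak G}<\mathrm{Aut}(\mathcal T_2)$ and $\Gamma,\overline\Gamma,\overline{\overline\Gamma}<\mathrm{Aut}(\mathcal T_3)$ be the five groups defined in the context. For each such group $G$, let $P_n$ be the stabilizer in $G$ of a vertex of level $n$ of the tree. (a) For $G=\mathfrak G$ and for $G=\tilde{\mathfrak G}$, the quasi-regular representation $\rho_{G/P_n}$ decomposes as a direct sum of $n+1$ irreducible components: one of degree $2^i$ for each $i\in\{1,\dots,n-1\}$, and two of degree $1$. (b) For $G=\Gamma$, $G=\overline\Gamma$ and $G=\overline{\overline\Gamma}$, the quasi-regular representation $\rho_{G/P_n}$ decomposes as a direct sum of $2n+1$ irreducible components: two of degree $3^i$ for each $i\in\{1,\dots,n-1\}$, and three of degree $1$.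
   Context: For $\Sigma=\{1,\dots,d\}$, $\mathcal T_d=\Sigma^*$ is the rooted tree whose vertices are the finite words over $\Sigma$, the children of $\sigma$ being the words $\sigma s$, $s\in\Sigma$; level $n$ is $\Sigma^n$. For $h\in\mathrm{Aut}(\mathcal T_d)$ fixing all words of length $1$, write $\psi(h)=(h_1,\dots,h_d)$ if $h(i\tau)=i\,h_i(\tau)$ for all $i\in\Sigma$, $\tau\in\Sigma^*$. Groups on $\mathcal T_2$: let $a$ be the automorphism exchanging the two branches at the root ($a(1\tau)=2\tau$, $a(2\tau)=1\tau$). Define recursively $b,c,d$ by $\psi(b)=(a,c)$, $\psi(c)=(a,d)$, $\psi(d)=(1,b)$, and $\mathfrak G=\langle a,b,c,d\rangle$. Define recursively $\tilde b,\tilde c,\tilde d$ by $\psi(\tilde b)=(a,\tilde c)$, $\psi(\tilde c)=(1,\tilde d)$, $\psi(\tilde d)=(1,\tilde b)$, and $\tilde{\mathfrak G}=\langle a,\tilde b,\tilde c,\tilde d\rangle$. Groups on $\mathcal T_3$: let $a$ be the automorphism cyclically permuting the three branches at the root ($1\tau\mapsto2\tau\mapsto3\tau\mapsto1\tau$). Define recursively $r,s,t$ by $\psi(r)=(a,1,r)$, $\psi(s)=(a,a,s)$, $\psi(t)=(a,a^{-1},t)$, and $\Gamma=\langle a,r\rangle$, $\overline\Gamma=\langle a,s\rangle$, $\overline{\overline\Gamma}=\langle a,t\rangle$. In these formulas $1$ as a component denotes the identity automorphism. All five groups act transitively on each level, so $P_n$ is well defined up to conjugacy and has index $d^n$. $\rho_{G/P_n}$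 is the complex representation of $G$ on $\ell^2(G/P_n)$ by left translation; ''degree'' means complex dimension. *)

(* Defs.v *)
From HB Require Import structures.
From mathcomp Require Import all_boot all_order all_algebra all_fingroup.
From mathcomp Require Import all_classical all_reals all_analysis.
From mathcomp Require Import complex ring.

Set Implicit Arguments.
Unset Strict Implicit.
Unset Printing Implicit Defensive.

Import Order.TTheory GRing.Theory Num.Theory.
Import numFieldNormedType.Exports.

Local Open Scope classical_set_scope.
Local Open Scope ring_scope.

(* The letter k of {1, ..., d} is the ordinal of value k - 1. *)
Notation word d := (seq 'I_d).

Definition child d (u w : word d) : Prop := exists s : 'I_d, w = rcons u s.

(* A tree automorphism is a permutation of the vertices that preserves and    *)
(* reflects the child relation; the root, the only vertex that is not a child *)
(* of another one, is then fixed.                                             *)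
Record treeAut (d : nat) := TreeAut {
  aut_fun :> word d -> word d;
  aut_inv : word d -> word d;
  aut_funK : cancel aut_fun aut_inv;
  aut_invK : cancel aut_inv aut_fun;
  aut_child : forall u w, child (aut_fun u) (aut_fun w) <-> child u w }.

Lemma treeAut_ext d (g h : treeAut d) : g =1 h -> g = h.
Proof.
case: g h => [f f' fK f'K fc] [k k' kK k'K kc] /= fk.
have e1 : f = k by apply: funext.
have e2 : f' = k'.
  by apply: funext => w; rewrite -{1}(k'K w) -fk fK.
by subst; congr TreeAut; exact: Prop_irrelevance.
Qed.

HB.instance Definition _ d := gen_eqMixin (treeAut d).
HB.instance Definition _ d := gen_choiceMixin (treeAut d).

Section AutGroup.
Variable d : nat.
Implicit Types g h : treeAut d.

Definition aut_one : treeAut d :=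
  @TreeAut d id id (fun=> erefl) (fun=> erefl) (fun _ _ => iff_refl _).

Definition aut_mul g h : treeAut d.
Proof.
apply: (@TreeAut d (g \o h) (aut_inv h \o aut_inv g)).
- exact: can_comp (aut_funK g) (aut_funK h).
- exact: can_comp (aut_invK h) (aut_invK g).
- by move=> u w /=; rewrite !aut_child.
Defined.

Definition aut_V g : treeAut d.
Proof.
apply: (@TreeAut d (aut_inv g) g (aut_invK g) (aut_funK g)).
by move=> u w; rewrite -(aut_child g) !aut_invK.
Defined.

Lemma aut_mulA : associative aut_mul.
Proof. by move=> g h k; apply: treeAut_ext. Qed.
Lemma aut_mul1 : left_id aut_one aut_mul.
Proof. by move=> g; apply: treeAut_ext. Qed.
Lemma aut_mulr1 : right_id aut_one aut_mul.
Proof. by move=> g; apply: treeAut_ext. Qed.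
Lemma aut_mulV : left_inverse aut_one aut_V aut_mul.
Proof. by move=> g; apply: treeAut_ext => w /=; exact: aut_funK. Qed.
Lemma aut_mulrV : right_inverse aut_one aut_V aut_mul.
Proof. by move=> g; apply: treeAut_ext => w /=; exact: aut_invK. Qed.

HB.instance Definition _ :=
  isGroup.Build (treeAut d) aut_mulA aut_mul1 aut_mulr1 aut_mulV aut_mulrV.

End AutGroup.

Lemma aut_mulE d (g h : treeAut d) w : (g * h)%g w = g (h w).
Proof. by []. Qed.

(* psi h = (h_1, ..., h_d) *)
Definition psi_eq d (h : treeAut d) (hs : d.-tuple (treeAut d)) : Prop :=
  forall (i : 'I_d) (w : word d), h (i :: w) = i :: tnth hs i w.

Section Generated.
Variables (gT : groupType) (S : seq gT).

Definition gen : {pred gT} := fun x =>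
  `[< forall H : {pred gT}, group_closed H -> {subset S <= H} -> x \in H >].

Lemma gen_closed : group_closed gen.
Proof.
split; first by apply/asboolP => H [].
move=> x y /asboolP xS /asboolP yS; apply/asboolP => H HG SH.
by apply: HG.2; [exact: xS | exact: yS].
Qed.

Definition genGroup := {x : gT | x \in gen}.

HB.instance Definition _ := Choice.on genGroup.
HB.instance Definition _ := SubChoice.on genGroup.
HB.instance Definition _ :=
  SubChoice_isSubGroup.Build gT gen genGroup gen_closed.

End Generated.

(* Automorphisms defined by simultaneous recursion: the state q acts on the   *)
(* first letter by [out q], then [next q i] acts on the rest of a word that   *)
(* began with i.                                                              *)
Section Recursion.
Variables (d : nat) (Q : Type) (out : Q -> {perm 'I_d}) (next : Q -> 'I_d -> Q).

Fixpoint run (q : Q) (w : word d) : word d :=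
  if w is i :: w' then out q i :: run (next q i) w' else [::].

Fixpoint runV (q : Q) (w : word d) : word d :=
  if w is i :: w' then
    let j := ((out q)^-1)%g i in j :: runV (next q j) w'
  else [::].

Lemma runK q : cancel (run q) (runV q).
Proof. by move=> w; elim: w q => //= i w IHw q; rewrite permK IHw. Qed.

Lemma runVK q : cancel (runV q) (run q).
Proof. by move=> w; elim: w q => //= i w IHw q; rewrite permKV IHw. Qed.

Lemma run_child_imp q u w : child u w -> child (run q u) (run q w).
Proof.
case=> s ->; elim: u q => [|i u IHu] q /=; first by exists (out q s).
by have [t ->] := IHu (next q i); exists t.
Qed.

Lemma runV_child_imp q u w : child u w -> child (runV q u) (runV q w).
Proof.
case=> s ->; elim: u q => [|i u IHu] q /=; first by exists ((out q)^-1 s)%g.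
by have [t ->] := IHu (next q (((out q)^-1)%g i)); exists t.
Qed.

Lemma run_child q u w : child (run q u) (run q w) <-> child u w.
Proof.
split; last exact: run_child_imp.
by move=> /(@runV_child_imp q); rewrite !runK.
Qed.

Definition recAut (q : Q) : treeAut d :=
  TreeAut (runK q) (runVK q) (run_child q).

End Recursion.

(* i |-> i + 1 modulo d *)
Definition rot_perm d : {perm 'I_d} := perm (@ordS_inj d).

(* Bt2, Ct2, Dt2 are the generators b, c, d with a tilde, and AV3 below is    *)
(* the inverse of a; lemmas psi_b to psi_t give the recursions for psi.      *)
Inductive state2 := One2 | A2 | B2 | C2 | D2 | Bt2 | Ct2 | Dt2.

Definition out2 (q : state2) : {perm 'I_2} :=
  if q is A2 then rot_perm 2 else 1%g.

Definition next2 (q : state2) (i : 'I_2) : state2 :=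
  match q with
  | One2 | A2 => One2
  | B2 => tnth [tuple A2; C2] i
  | C2 => tnth [tuple A2; D2] i
  | D2 => tnth [tuple One2; B2] i
  | Bt2 => tnth [tuple A2; Ct2] i
  | Ct2 => tnth [tuple One2; Dt2] i
  | Dt2 => tnth [tuple One2; Bt2] i
  end.

Definition aut2 : state2 -> treeAut 2 := recAut out2 next2.

Inductive state3 := One3 | A3 | AV3 | R3 | S3 | T3.

Definition out3 (q : state3) : {perm 'I_3} :=
  match q with
  | A3 => rot_perm 3
  | AV3 => ((rot_perm 3)^-1)%g
  | _ => 1%g
  end.

Definition next3 (q : state3) (i : 'I_3) : state3 :=
  match q with
  | One3 | A3 | AV3 => One3
  | R3 => tnth [tuple A3; One3; R3] i
  | S3 => tnth [tuple A3; A3; S3] i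
  | T3 => tnth [tuple A3; AV3; T3] i
  end.

Definition aut3 : state3 -> treeAut 3 := recAut out3 next3.

Lemma aut2_one : aut2 One2 = 1%g.
Proof.
by apply: treeAut_ext; elim=> //= i w; rewrite /= perm1 => ->.
Qed.

Lemma aut3_one : aut3 One3 = 1%g.
Proof.
by apply: treeAut_ext; elim=> //= i w; rewrite /= perm1 => ->.
Qed.

Lemma aut2_aE (i : 'I_2) (w : word 2) : aut2 A2 (i :: w) = ordS i :: w.
Proof.
rewrite /= permE; congr cons.
by have := congr1 (fun g : treeAut 2 => g w) aut2_one.
Qed.

Lemma aut3_aE (i : 'I_3) (w : word 3) : aut3 A3 (i :: w) = ordS i :: w.
Proof.
rewrite /= permE; congr cons.
by have := congr1 (fun g : treeAut 3 => g w) aut3_one.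
Qed.

Lemma aut3_aV : aut3 AV3 = ((aut3 A3)^-1)%g.
Proof.
apply: treeAut_ext => -[|i w] //=; congr cons.
apply: (can_inj (runK out3 next3 One3)); rewrite runVK.
by have e1 v : run out3 next3 One3 v = v
  := congr1 (fun g : treeAut 3 => g v) aut3_one; rewrite e1.
Qed.

Lemma psi_b : psi_eq (aut2 B2) [tuple aut2 A2; aut2 C2].
Proof. by case=> [[|[|]]] //= ? w; rewrite perm1. Qed.
Lemma psi_c : psi_eq (aut2 C2) [tuple aut2 A2; aut2 D2].
Proof. by case=> [[|[|]]] //= ? w; rewrite perm1. Qed.
Lemma psi_d : psi_eq (aut2 D2) [tuple 1%g; aut2 B2].
Proof. by rewrite -aut2_one; case=> [[|[|]]] //= ? w; rewrite perm1. Qed.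
Lemma psi_bt : psi_eq (aut2 Bt2) [tuple aut2 A2; aut2 Ct2].
Proof. by case=> [[|[|]]] //= ? w; rewrite perm1. Qed.
Lemma psi_ct : psi_eq (aut2 Ct2) [tuple 1%g; aut2 Dt2].
Proof. by rewrite -aut2_one; case=> [[|[|]]] //= ? w; rewrite perm1. Qed.
Lemma psi_dt : psi_eq (aut2 Dt2) [tuple 1%g; aut2 Bt2].
Proof. by rewrite -aut2_one; case=> [[|[|]]] //= ? w; rewrite perm1. Qed.
Lemma psi_r : psi_eq (aut3 R3) [tuple aut3 A3; 1%g; aut3 R3].
Proof. by rewrite -aut3_one; case=> [[|[|[|]]]] //= ? w; rewrite perm1. Qed.
Lemma psi_s : psi_eq (aut3 S3) [tuple aut3 A3; aut3 A3; aut3 S3].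
Proof. by case=> [[|[|[|]]]] //= ? w; rewrite perm1. Qed.
Lemma psi_t : psi_eq (aut3 T3) [tuple aut3 A3; (aut3 A3)^-1%g; aut3 T3].
Proof. by rewrite -aut3_aV; case=> [[|[|[|]]]] //= ? w; rewrite perm1. Qed.

Definition frakG := genGroup [:: aut2 A2; aut2 B2; aut2 C2; aut2 D2].
Definition frakGtilde := genGroup [:: aut2 A2; aut2 Bt2; aut2 Ct2; aut2 Dt2].
Definition Gamma := genGroup [:: aut3 A3; aut3 R3].
Definition Gambar := genGroup [:: aut3 A3; aut3 S3].
Definition Gambarbar := genGroup [:: aut3 A3; aut3 T3].

Definition vstab d (S : seq (treeAut d)) (v : word d) : set (genGroup S) :=
  [set g | (val (g : genGroup S) : treeAut d) v = v].

Record representation (F : fieldType) (G : groupType) (V : lmodType F) :=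
  Representation {
    ract :> G -> {linear V -> V};
    ract1 : forall v, ract 1%g v = v;
    ractM : forall g h v, ract (g * h)%g v = ract g (ract h v) }.

Section Decomposition.
Variables (F : fieldType) (G : groupType) (V : lmodType F).
Variable rho : representation G V.

Definition subrep (W : {pred V}) : Prop :=
  submod_closed W /\ forall g v, v \in W -> rho g v \in W.

Definition irreducible_subrep (W : {pred V}) : Prop :=
  [/\ subrep W,
      exists2 v, v \in W & v != 0
    & forall U : {pred V}, subrep U -> {subset U <= W} ->
        (forall u, u \in U -> u = 0) \/ {subset W <= U}].

Definition has_dim (W : {pred V}) (n : nat) : Prop :=
  exists e : 'I_n -> V, (forall i, e i \in W) /\
    forall v, v \in W ->
      exists! c : {ffun 'I_n -> F}, v = \sum_(i < n) c i *: e i.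

Definition direct_sum m (W : 'I_m -> {pred V}) : Prop :=
  forall v : V, exists! w : {ffun 'I_m -> V},
    (forall i, w i \in W i) /\ v = \sum_(i < m) w i.

(* rho is a direct sum of m irreducible components, whose degrees, counted    *)
(* with multiplicity, are listed by degs in some order.                       *)
Definition irreducible_decomposition (m : nat) (degs : seq nat) : Prop :=
  exists (W : 'I_m -> {pred V}) (deg : 'I_m -> nat),
    [/\ forall i, irreducible_subrep (W i),
        direct_sum W,
        forall i, has_dim (W i) (deg i)
      & perm_eq [seq deg i | i <- enum 'I_m] degs].

End Decomposition.

Section Cosets.
Variables (G : groupType) (P : set G).

Definition ltrans (g : G) (C : set G) : set G := [set (g * x)%g | x in C].

Definition lcosets : set (set G) := [set ltrans g P | g in [set: G]].

Definition coset_space := {C : set G | C \in lcosets}.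

HB.instance Definition _ := Choice.on coset_space.

Lemma ltrans1 C : ltrans 1%g C = C.
Proof.
apply/seteqP; split=> x /=; first by case=> y Cy <-; rewrite mul1g.
by move=> Cx; exists x; rewrite ?mul1g.
Qed.

Lemma ltransM g h C : ltrans (g * h)%g C = ltrans g (ltrans h C).
Proof.
apply/seteqP; split=> x /=.
  by case=> y Cy <-; exists (h * y)%g; rewrite ?mulgA//; exists y.
by case=> y [z Cz <-] <-; exists z; rewrite // mulgA.
Qed.

Lemma ltrans_lcosets g (C : coset_space) : ltrans g (val C) \in lcosets.
Proof.
case: C => C /= /set_mem[h _ <-]; apply/mem_set.
by exists (g * h)%g => //; rewrite ltransM.
Qed.

Definition coset_act (g : G) (C : coset_space) : coset_space :=
  exist _ (ltrans g (val C)) (ltrans_lcosets g C).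

Lemma coset_act1 C : coset_act 1%g C = C.
Proof. by apply: val_inj; exact: ltrans1. Qed.

Lemma coset_actM g h C :
  coset_act (g * h)%g C = coset_act g (coset_act h C).
Proof. by apply: val_inj; exact: ltransM. Qed.

Lemma coset_act_bij g : bijective (coset_act g).
Proof.
exists (coset_act g^-1%g) => C.
  by rewrite -coset_actM mulVg coset_act1.
by rewrite -coset_actM mulgV coset_act1.
Qed.

End Cosets.

Section Ell2.
Variables (R : realType) (X : choiceType).

(* |z|^2 as an element of R: the norm `|z| of the library is in R[i]. *)
Definition sqnorm (z : R[i]) : R := complex.Re z ^+ 2 + complex.Im z ^+ 2.

Definition square_summable : {pred X -> R[i]^o} := fun f =>
  `[< summable [set: X] (fun x => (sqnorm (f x))%:E) >].

Lemma sqnorm_ge0 z : 0 <= sqnorm z.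
Proof. by rewrite addr_ge0 ?sqr_ge0. Qed.

Lemma square_summableP f : reflect
  (\esum_(x in [set: X]) (sqnorm (f x))%:E < +oo)%E (f \in square_summable).
Proof.
apply: (iffP (asboolP _)); rewrite /summable => h.
  by move: h; under eq_esum do rewrite gee0_abs ?lee_fin ?sqnorm_ge0//.
by under eq_esum do rewrite gee0_abs ?lee_fin ?sqnorm_ge0//.
Qed.

Lemma sqnormM z w : sqnorm (z * w) = sqnorm z * sqnorm w.
Proof. by case: z w => [a b] [c e]; rewrite /sqnorm /=; ring. Qed.

Lemma sqnormD z w : sqnorm (z + w) <= 2 * sqnorm z + 2 * sqnorm w.
Proof.
case: z w => [a b] [c e]; rewrite /sqnorm /= -subr_ge0.
rewrite [leRHS](_ : _ = (a - c) ^+ 2 + (b - e) ^+ 2); last by ring.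
by rewrite addr_ge0 ?sqr_ge0.
Qed.

Lemma esum_scale_lty (k : R) (a : X -> R) : 0 <= k -> (forall x, 0 <= a x) ->
  (\esum_(x in [set: X]) (a x)%:E < +oo ->
   \esum_(x in [set: X]) (k * a x)%:E < +oo)%E.
Proof.
move=> k0 a0 afin.
have a_ge0 : (0 <= \esum_(x in [set: X]) (a x)%:E)%E.
  by apply: esum_ge0 => x _; rewrite lee_fin.
apply: (@le_lt_trans _ _ (k%:E * \esum_(x in [set: X]) (a x)%:E)%E); last first.
  by rewrite lte_mul_pinfty// lee_fin.
apply: ge_ereal_sup => _ [A [finA AT] <-].
under eq_fsbigr do rewrite EFinM.
rewrite -ge0_mule_fsumr; last by move=> x; rewrite lee_fin.
rewrite lee_wpmul2l ?lee_fin//; apply: ereal_sup_ubound; by exists A.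
Qed.

Lemma square_summable_closed : GRing.subsemimod_closed square_summable.
Proof.
split; first split.
- apply/square_summableP; rewrite esum1 ?ltry// => x _.
  by rewrite /sqnorm /= expr0n/= addr0.
- move=> f g /square_summableP sf /square_summableP sg.
  apply/square_summableP.
  apply: (@le_lt_trans _ _ (\esum_(x in [set: X])
      ((2 * sqnorm (f x))%:E + (2 * sqnorm (g x))%:E))%E).
    by apply: le_esum => x _; rewrite -EFinD lee_fin; exact: sqnormD.
  rewrite esumD; first by rewrite lte_add_pinfty// esum_scale_lty//;
    move=> x; exact: sqnorm_ge0.
    by move=> x _; rewrite lee_fin mulr_ge0// sqnorm_ge0.
  by move=> x _; rewrite lee_fin mulr_ge0// sqnorm_ge0.
- move=> c f /square_summableP sf; apply/square_summableP.
  rewrite (eq_esum (b := fun x => (sqnorm c * sqnorm (f x))%:E)); last first.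
    by move=> x _; rewrite -sqnormM.
  by apply: esum_scale_lty => // [|x]; exact: sqnorm_ge0.
Qed.

Definition ell2 := {f : X -> R[i]^o | f \in square_summable}.

HB.instance Definition _ := Choice.on ell2.
HB.instance Definition _ := SubChoice.on ell2.
HB.instance Definition _ := GRing.SubChoice_isSubLmodule.Build _ _
  square_summable ell2 square_summable_closed.

Definition ell2_of (f : X -> R[i]^o) (hf : f \in square_summable) : ell2 :=
  exist _ f hf.

End Ell2.

Section QuasiRegular.
Variables (R : realType) (G : groupType) (P : set G).
Local Notation X := (coset_space P).

Lemma translate_square_summable (g : G) (f : ell2 R X) :
  (val f \o coset_act g^-1%g : X -> R[i]^o) \in @square_summable R X.
Proof.
apply/square_summableP.
rewrite -(reindex_esum [set: X] [set: X] (coset_act g^-1%g)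
  (fun x => (sqnorm (val f x))%:E)); first exact/square_summableP/(valP f).
by rewrite setTT_bijective; exact: coset_act_bij.
Qed.

(* (g . f)(C) = f(g^-1 C) *)
Definition qr_act (g : G) (f : ell2 R X) : ell2 R X :=
  ell2_of (translate_square_summable g f).

Lemma qr_act_linear g : linear (qr_act g).
Proof. by move=> c f h; apply: val_inj. Qed.

HB.instance Definition _ g := GRing.isLinear.Build R[i] (ell2 R X) (ell2 R X)
  *:%R (qr_act g) (qr_act_linear g).

Lemma qr_act1 f : qr_act 1%g f = f.
Proof.
by apply: val_inj; apply: funext => C /=; rewrite invg1 coset_act1.
Qed.

Lemma qr_actM g h f : qr_act (g * h)%g f = qr_act g (qr_act h f).
Proof.
by apply: val_inj; apply: funext => C /=; rewrite invgM coset_actM.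
Qed.

Definition quasi_regular : representation G (ell2 R X) :=
  @Representation R[i] G (ell2 R X) (fun g => qr_act g : {linear _ -> _})
    qr_act1 qr_actM.

End QuasiRegular.

(* Main.v *)
Require Import Defs.
From HB Require Import structures.
From mathcomp Require Import all_boot all_order all_algebra all_fingroup.
From mathcomp Require Import all_classical all_reals all_analysis.
From mathcomp Require Import complex.

Set Implicit Arguments.
Unset Strict Implicit.
Unset Printing Implicit Defensive.

Import Order.TTheory GRing.Theory Num.Theory.

(* Each of the five groups acts at every vertex by powers of the d-cycle, and  *)
(* is transitive on the pairs of vertices of a level that share a given common *)
(* prefix u and have, at the place where they branch, a given difference mod d.*)
(* For the latter, self-replication reduces to u empty: then one needs the     *)
(* stabilizer of level 1 to be transitive on i0 Sigma^m x j0 Sigma^m.          *)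
(* Commutators in that stabilizer provide elements that are trivial below j0;  *)
(* their sections below i0 form a normal subgroup, and a normal subgroup       *)
(* containing suitable elements ks contains elements with sections ks, hence   *)
(* is transitive on all levels by induction.                                   *)
(*                                                                             *)
(* G/P_n is level n. Fourier analysis in the letter k + 1 splits the functions *)
(* on level n into constants and, for k < n and 0 < e < d, the functions       *)
(* w |-> omega^(e w_(k+1)) q(w_1 ... w_k), a space of dimension d^k on which G *)
(* acts by monomial matrices. It is irreducible: averaging a function over the *)
(* stabilizer of a vertex of level k + 1 kills all coordinates q(u) but one,   *)
(* because that stabilizer rotates the children of any other vertex of level k.*)

(** * Transitivity of branching groups *)

(** Let [d] be 2 or 3 and [omega] a primitive [d]-th root of unity. Expanding a function on level
    [n] in characters of its last letter, and repeating this with the zero-frequency coefficient,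
    writes it uniquely as a constant plus terms in [component e k], for [0 < e < d] and [k < n]
    ([fourier_exists], [fourier_uniq]). The degrees are [d ^ k]; the constants and the components
    with [k = 0] give the [d] summands of degree 1.

    The group enters through [cyclically_homogeneous]. Local rotations make each component invariant
    ([chi_letter]); transitivity on levels, and the possibility of rotating below one vertex while
    fixing a child of another, make it irreducible ([component_irreducible]).

    [branching_criterion] derives this property from finitely many checks on level-1 sections. For
    each group the work lies in choosing the list [ks] so that every normalized subgroup containing
    [ks] has [ks] again among its sections, and in exhibiting group elements that act below one
    letter and trivially below another. *)

Section TreeAutomorphisms.
Variable d : nat.
Implicit Types (g h x y : treeAut d) (i j k : 'I_d) (u v w : word d).

Lemma aut_nil x : x [::] = [::].
Proof.
move E: (x [::]) => t; case/lastP: t E => // v s E.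
suff [t /(congr1 size)] : child (aut_inv x v) [::] by rewrite size_rcons.
by apply/(aut_child x); rewrite aut_invK E; exists s.
Qed.

Lemma aut_rcons x u i : exists j, x (rcons u i) = rcons (x u) j.
Proof. by apply/(aut_child x); exists i. Qed.

Lemma size_aut x w : size (x w) = size w.
Proof.
elim/last_ind: w => [|w i IHw]; first by rewrite aut_nil.
by have [j ->] := aut_rcons x w i; rewrite !size_rcons IHw.
Qed.

Lemma aut_cat x u w : exists v, x (u ++ w) = x u ++ v.
Proof.
elim/last_ind: w => [|w i [v IHw]]; first by exists [::]; rewrite !cats0.
have [j] := aut_rcons x (u ++ w) i; rewrite -rcons_cat => ->.
by exists (rcons v j); rewrite IHw rcons_cat.
Qed.

Lemma aut_take x m w : x (take m w) = take m (x w).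
Proof.
have [v E] := aut_cat x (take m w) (drop m w).
rewrite cat_take_drop in E; rewrite E.
have [le_wm|lt_mw] := leqP (size w) m.
  have := congr1 size E; rewrite size_cat !size_aut take_oversize //.
  rewrite -{1}[size w]addn0 => /eqP; rewrite eqn_add2l eq_sym => /nilP ->.
  by rewrite cats0 take_oversize // size_aut.
by rewrite take_size_cat // size_aut size_takel // ltnW.
Qed.

(** In the usual language, [y] is the section of [x] at the first-level vertex [i]. *)
Definition sends x i j y := forall v, x (i :: v) = j :: y v.

Lemma sendsM x x' i j k y y' :
  sends x j k y -> sends x' i j y' -> sends (x * x')%g i k (y * y')%g.
Proof. by move=> xy xy' v; rewrite aut_mulE xy' xy. Qed.

Lemma sendsV x i j y : sends x i j y -> sends x^-1%g j i y^-1%g.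
Proof.
move=> xy v; apply: (can_inj (aut_funK x)).
by rewrite xy -!aut_mulE !mulgV.
Qed.

Lemma sends_head x i j y : sends x i j y -> x [:: i] = [:: j].
Proof. by move=> ->; rewrite aut_nil. Qed.

Lemma head_cons x i j v : x [:: i] = [:: j] -> exists v', x (i :: v) = j :: v'.
Proof. by move=> xi; have [v' E] := aut_cat x [:: i] v; exists v'; rewrite E xi. Qed.

Lemma headV x i j : x [:: i] = [:: j] -> x^-1%g [:: j] = [:: i].
Proof. by move=> <-; rewrite -aut_mulE mulVg. Qed.

End TreeAutomorphisms.

(** * Subgroups normalized by a self-replicating group, and their sections *)

Section Transitivity.
Variables (d' : nat).
Local Notation d := d'.+1.
Variable S : seq (treeAut d).
Local Notation G := (gen S).
Implicit Types (g h x y : treeAut d) (i j : 'I_d) (u v w : word d).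
Implicit Types H : {pred treeAut d}.

Lemma gen1 : 1%g \in G. Proof. exact: (gen_closed S).1. Qed.
Lemma genV g : g \in G -> g^-1%g \in G.
Proof. exact: group_closedV (gen_closed S) g. Qed.
Lemma genM g h : g \in G -> h \in G -> (g * h)%g \in G.
Proof. exact: group_closedM (gen_closed S) g h. Qed.

Lemma gen_sub g : g \in S -> g \in G.
Proof. by move=> gS; apply/asboolP => H _; exact. Qed.

Lemma gen_min H : group_closed H -> {subset S <= H} -> {subset G <= H}.
Proof. by move=> gH SH g /asboolP; apply. Qed.

(** [H] may or may not lie in [G], so that sets of sections of elements of [G] qualify. *)
Definition normalized H := group_closed H /\
  forall g x, g \in G -> x \in H -> (g * x * g^-1)%g \in H.

Definition sec H i : {pred treeAut d} :=
  fun y => `[< exists2 x, x \in H & sends x i i y >].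

Lemma sec_closed H i : group_closed H -> group_closed (sec H i).
Proof.
move=> gH; split; first by apply/asboolP; exists 1%g => //; exact: gH.1.
move=> y y' /asboolP[x xH xy] /asboolP[x' x'H xy'].
apply/asboolP; exists (x * x'^-1)%g; first exact: gH.2.
exact: sendsM xy (sendsV xy').
Qed.

Lemma gen_normalized : normalized G.
Proof.
split; first exact: gen_closed.
by move=> g x gG xG; rewrite !genM // genV.
Qed.

Hypothesis d_rot : exists2 a, a \in G & forall i, sends a i (ordS i) 1%g.

Lemma iter_ordS i j : exists n, iter n (@ordS d) i = j.
Proof.
exists (j + (d - i))%N; apply: val_inj.
have E n : val (iter n (@ordS d) i) = ((i + n) %% d)%N.
  elim: n => [|n IHn] /=; first by rewrite addn0 modn_small.
  by rewrite IHn -addn1 modnDml -addnA addn1.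
by rewrite E addnCA subnKC ?modnDr ?modn_small // ltnW.
Qed.

Lemma rot_to i j : exists2 a, a \in G & sends a i j 1%g.
Proof.
have [n <-] := iter_ordS i j; have [a aG ea] := d_rot.
elim: n => [|n [b bG eb]]; first by exists 1%g => //; exact: gen1.
exists (a * b)%g; first exact: genM.
by rewrite -(mul1g 1%g); exact: sendsM (ea _) eb.
Qed.

(** Conjugation by a power of the rotation moves [i] to [j] and leaves the section unchanged,
    because the rotation has trivial sections. *)
Lemma sec_indep H i j : normalized H -> {subset sec H i <= sec H j}.
Proof.
move=> [_ nH] y /asboolP[x xH xy]; have [a aG ea] := rot_to i j.
apply/asboolP; exists (a * x * a^-1)%g; first exact: nH.
have := sendsM (sendsM ea xy) (sendsV ea).
by rewrite mul1g invg1 mulg1.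
Qed.

Hypothesis self_replicating :
  forall g, g \in S -> exists i, g \in sec G i.

Lemma sec_gen g i : g \in G -> g \in sec G i.
Proof.
apply: gen_min => [|h /self_replicating[j]]; first exact/sec_closed/gen_closed.
exact/sec_indep/gen_normalized.
Qed.

(** By [sec_gen] an element [g] of [G] is itself a section at [i] of some [h] in [G]; conjugating by
    [h] upstairs conjugates sections by [g]. *)
Lemma sec_normalized H i : normalized H -> normalized (sec H i).
Proof.
move=> [gH nH]; split; first exact: sec_closed.
move=> g y /(@sec_gen _ i)/asboolP[h hG hg] /asboolP[x xH xy].
apply/asboolP; exists (h * x * h^-1)%g; first exact: nH.
exact: sendsM (sendsM hg xy) (sendsV hg).
Qed.

Lemma normalizedM H x y : normalized H -> x \in H -> y \in H -> (x * y)%g \in H.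
Proof. by move=> [gH _]; exact: group_closedM gH x y. Qed.

Lemma normalizedV H x : normalized H -> x \in H -> x^-1%g \in H.
Proof. by move=> [gH _]; exact: group_closedV gH x. Qed.

(* Normal subgroups containing [ks] pass this property on to their sections,   *)
(* which is what makes the induction on the level work.                        *)
Variable ks : seq (treeAut d).
Hypothesis ks_rot : exists2 k, k \in ks & forall i, k [:: i] = [:: ordS i].
Hypothesis ks_sec : forall H, normalized H -> {subset ks <= H} ->
  forall k, k \in ks -> exists i, k \in sec H i.

Lemma rot_iter x : (forall i, x [:: i] = [:: ordS i]) ->
  forall n i, (x ^+ n)%g [:: i] = [:: iter n (@ordS d) i].
Proof.
move=> ex; elim=> [|n IHn] i; first by rewrite expg0.
by rewrite expgS aut_mulE IHn ex.
Qed.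

Lemma fix_iter x : (forall i, x [:: i] = [:: i]) ->
  forall n i, (x ^+ n)%g [:: i] = [:: i].
Proof.
move=> ex; elim=> [|n IHn] i; first by rewrite expg0.
by rewrite expgS aut_mulE IHn ex.
Qed.

Lemma normalizedX H x n : normalized H -> x \in H -> (x ^+ n)%g \in H.
Proof.
move=> nH xH; elim: n => [|n IHn]; first by rewrite expg0; exact: nH.1.1.
by rewrite expgS; exact: normalizedM.
Qed.

(** Induction on the word, for all [H] at once: a power of an element of [ks] aligns the first
    letters, and [sec H j] is again normalized and contains [ks], so it handles the tails. *)
Lemma normalized_transitive H : normalized H -> {subset ks <= H} ->
  forall v w, size v = size w -> exists2 x, x \in H & x v = w.
Proof.
move=> nH ksH v; elim: v H nH ksH => [|i v IHv] H nH ksH [|j w] //=.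
  by exists 1%g => //; exact: nH.1.1.
move=> [sz_vw]; have [k kks k_rot] := ks_rot.
have [n nij] := iter_ordS i j.
have [v' E] := head_cons v (etrans (rot_iter k_rot n i) (congr1 (cons^~ [::]) nij)).
have sz_v' : size v' = size v.
  by have := congr1 size E; rewrite size_aut => -[].
have ksH' : {subset ks <= sec H j}.
  move=> l lks; have [i' li'] := ks_sec nH ksH lks.
  exact: sec_indep nH _ li'.
have nH' := sec_normalized j nH.
(* The induction hypothesis only moves [v], so [v'] is joined to [w] through [v]. *)
have [y1 /asboolP[x1 x1H e1] y1v] := IHv _ nH' ksH' v' (esym sz_v').
have [y2 /asboolP[x2 x2H e2] y2v] := IHv _ nH' ksH' w sz_vw.
exists (x2 * x1^-1 * k ^+ n)%g.
  by rewrite !(normalizedM nH) ?(normalizedV nH) ?(normalizedX _ nH) // ksH.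
rewrite !aut_mulE E (sendsV e1) e2; congr cons.
by rewrite -y1v -(aut_mulE y1^-1%g) mulVg.
Qed.

Hypothesis level1_free : forall g i, g \in G -> g [:: i] = [:: i] ->
  forall j, g [:: j] = [:: j].

(* The elements acting below [i] as an element of the stabilizer of level 1   *)
(* that is trivial below [j].                                                 *)
Definition side i j : {pred treeAut d} := fun x =>
  `[< exists2 h, h \in G & sends h i i x /\ sends h j j 1%g >].

(** Lift the conjugator to an [h] in [G] fixing [i]. By [level1_free] it fixes [j] too, so
    conjugating by [h] keeps the section at [j] trivial. *)
Lemma side_normalized i j : normalized (side i j).
Proof.
split; first split.
- by apply/asboolP; exists 1%g; [exact: gen1 | split].
- move=> x y /asboolP[h hG [hx hj]] /asboolP[h' h'G [hy hj']].
  apply/asboolP; exists (h * h'^-1)%g; first by rewrite genM ?genV.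
  split; first exact: sendsM hx (sendsV hy).
  by rewrite -[1%g](mulgV 1%g); exact: sendsM hj (sendsV hj').
- move=> g x /(@sec_gen _ i)/asboolP[h hG hg] /asboolP[h' h'G [hx hj]].
  apply/asboolP; exists (h * h' * h^-1)%g; first by rewrite !genM ?genV.
  split; first exact: sendsM (sendsM hg hx) (sendsV hg).
  move=> v.
  have /(head_cons v)[v' E] :=
    headV (level1_free hG (sends_head hg) j).
  by rewrite !aut_mulE E hj -E -aut_mulE mulgV.
Qed.

Variables i0 j0 : 'I_d.
Hypothesis ks_side : forall k, k \in ks ->
  (exists i, k \in sec (side i0 j0) i) /\ (exists i, k \in sec (side j0 i0) i).
Hypothesis rot_left : exists h x y, [/\ h \in G, sends h i0 i0 x, sends h j0 j0 y,
  forall i, x [:: i] = [:: ordS i] & forall i, y [:: i] = [:: i]].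
Hypothesis rot_right : exists h x y, [/\ h \in G, sends h i0 i0 x, sends h j0 j0 y,
  forall i, x [:: i] = [:: i] & forall i, y [:: i] = [:: ordS i]].

Lemma sendsX x i y n : sends x i i y -> sends (x ^+ n)%g i i (y ^+ n)%g.
Proof.
move=> xy; elim: n => [|n IHn]; first by rewrite !expg0.
by rewrite !expgS; exact: sendsM.
Qed.

Lemma side_transitive i j k v w :
  (forall l, l \in ks -> exists k', l \in sec (side i j) k') ->
  size v = size w ->
  exists2 h, h \in G & sends h j j 1%g /\ h [:: i, k & v] = [:: i, k & w].
Proof.
move=> ksij sz_vw; have nS := side_normalized i j.
have ksk : {subset ks <= sec (side i j) k}.
  by move=> l /ksij[k' lk']; exact: sec_indep nS _ lk'.
have [y /asboolP[x /asboolP[h hG [hx hj]] xy] yv] :=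
  normalized_transitive (sec_normalized k nS) ksk sz_vw.
by exists h => //; split=> //; rewrite hx xy yv.
Qed.

(** Powers of the elements of [rot_left] and [rot_right] adjust the second letters below [i0] and
    [j0] independently. The remaining tails are then corrected by [side_transitive], one side at a
    time, as each correction is trivial on the other side. *)
Lemma pair_transitive v w v' w' : size v = size w -> size v = size v' ->
  size w = size w' -> exists2 h, h \in G &
  h (i0 :: v) = i0 :: v' /\ h (j0 :: w) = j0 :: w'.
Proof.
case: v w v' w' => [|i v] [|j w] [|i' v'] [|j' w'] //=.
  by move=> _ _ _; exists 1%g => //; exact: gen1.
move=> _ [sz_v] [sz_w].
have [n nii'] := iter_ordS i i'; have [m mjj'] := iter_ordS j j'.
have [h1 [x1 [y1 [h1G hx1 hy1 rx1 fy1]]]] := rot_left.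
have [h2 [x2 [y2 [h2G hx2 hy2 fx2 ry2]]]] := rot_right.
have [v1 Ev1] := head_cons v (etrans (rot_iter rx1 n i) (congr1 (cons^~ [::]) nii')).
have [v2 Ev2] := head_cons v1 (fix_iter fx2 m i').
have [w1 Ew1] := head_cons w (fix_iter fy1 n j).
have [w2 Ew2] := head_cons w1 (etrans (rot_iter ry2 m j) (congr1 (cons^~ [::]) mjj')).
have := congr1 size Ev1; have := congr1 size Ev2.
rewrite !size_aut /= => -[sz2] [sz1].
have := congr1 size Ew1; have := congr1 size Ew2.
rewrite !size_aut /= => -[sz4] [sz3].
have [h3 h3G [h3j h3v]] := side_transitive i' (fun l lks => (ks_side lks).1)
  (etrans (esym sz2) (etrans (esym sz1) sz_v)).
have [h4 h4G [h4i h4w]] := side_transitive j' (fun l lks => (ks_side lks).2)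
  (etrans (esym sz4) (etrans (esym sz3) sz_w)).
exists (h4 * h3 * (h2 ^+ m * h1 ^+ n))%g.
  by rewrite !genM // (normalizedX _ gen_normalized).
split; rewrite !aut_mulE.
- by rewrite (sendsX n hx1) Ev1 (sendsX m hx2) Ev2 h3v h4i.
- by rewrite (sendsX n hy1) Ew1 (sendsX m hy2) Ew2 h3j.
Qed.

Hypothesis i0j0 : forall i j, i != j -> exists n,
  (i, j) = (iter n (@ordS d) i0, iter n (@ordS d) j0) \/
  (i, j) = (iter n (@ordS d) j0, iter n (@ordS d) i0).

Lemma rot_iter_gen n : exists2 a, a \in G &
  forall i, sends a i (iter n (@ordS d) i) 1%g.
Proof.
have [a aG ea] := d_rot.
elim: n => [|n [b bG eb]]; first by exists 1%g => //; exact: gen1.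
exists (a * b)%g => [|i]; first exact: genM.
by rewrite -(mul1g 1%g); exact: sendsM (ea _) (eb _).
Qed.

Lemma branch_transitive i j v w v' w' : i != j ->
  size v = size w -> size v = size v' -> size w = size w' ->
  exists2 h, h \in G & h (i :: v) = i :: v' /\ h (j :: w) = j :: w'.
Proof.
move=> /i0j0[n E] sz_vw sz_v sz_w; have [a aG ea] := rot_iter_gen n.
case: E => -[-> ->].
- have [h hG [hv hw]] := pair_transitive sz_vw sz_v sz_w.
  exists (a * h * a^-1)%g; first by rewrite !genM ?genV.
  by rewrite !aut_mulE !(sendsV (ea _)) !invg1 hv hw !ea.
- have [h hG [hv hw]] := pair_transitive (esym sz_vw) sz_w sz_v.
  exists (a * h * a^-1)%g; first by rewrite !genM ?genV.
  by rewrite !aut_mulE !(sendsV (ea _)) !invg1 hv hw !ea.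
Qed.

Definition separately_transitive := forall u u' v w w',
  size u = size u' -> u != u' -> size v = size w -> size w = size w' ->
  exists2 g, g \in G & g (u ++ v) = u ++ v /\ g (u' ++ w) = u' ++ w'.

(** A common first letter is stripped by lifting through [sec_gen]; once the first letters differ,
    [branch_transitive] applies. *)
Lemma gen_separately_transitive : separately_transitive.
Proof.
elim=> [|i u IHu] [|j u'] v w w' //= [sz_u] neq sz_v sz_w.
have [eq_ij|neq_ij] := eqVneq i j.
  rewrite -eq_ij eqseq_cons eqxx /= in neq *.
  have [g gG [gu gu']] := IHu _ _ _ _ sz_u neq sz_v sz_w.
  have /asboolP[h hG hg] := sec_gen i gG.
  by exists h => //; rewrite !hg gu gu'.
have [|||h hG [hv hw]] :=
  @branch_transitive i j (u ++ v) (u' ++ w) (u ++ v) (u' ++ w') neq_ij.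
- by rewrite !size_cat sz_u sz_v.
- by [].
- by rewrite !size_cat sz_w.
by exists h.
Qed.

Hypothesis ks_gen : {subset ks <= G}.

Definition level_transitive := forall v w, size v = size w ->
  exists2 g, g \in G & g v = w.

Lemma gen_level_transitive : level_transitive.
Proof. exact: normalized_transitive gen_normalized ks_gen. Qed.

End Transitivity.

(** * Local rotations and the criterion for the five groups *)

Section Criterion.
Variables (d' : nat).
Local Notation d := d'.+1.
Implicit Types (g h x y : treeAut d) (i j : 'I_d) (u v w : word d).

Definition locally_cyclic g := forall u, exists2 s : {perm 'I_d},
  s \in <[rot_perm d]>%g & forall i, g (rcons u i) = rcons (g u) (s i).

Lemma rot_permE i : rot_perm d i = ordS i. Proof. exact: permE. Qed.

(** [s] commutes with the transitive rotation, hence its fixed points are all or nothing. *)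
Lemma rot_perm_free s i j : s \in <[rot_perm d]>%g -> s i = i -> s j = j.
Proof.
move=> sR si; have [n <-] := iter_ordS i j.
have sC : (rot_perm d * s = s * rot_perm d)%g.
  by case/cycleP: sR => m ->; rewrite -expgSr -expgS.
by elim: n => //= n IHn; rewrite -rot_permE -permM sC permM IHn.
Qed.

Lemma locally_cyclic_closed :
  group_closed ((fun g => `[< locally_cyclic g >]) : {pred treeAut d}).
Proof.
split; first by apply/asboolP => u; exists 1%g => [|i]; rewrite ?group1 ?perm1.
move=> g h /asboolP gC /asboolP hC; apply/asboolP => u.
have [s sR Es] := gC ((h^-1)%g u); have [t tR Et] := hC ((h^-1)%g u).
have EV i : (h^-1)%g (rcons u (t i)) = rcons ((h^-1)%g u) i.
  by apply: (can_inj (aut_funK h)); rewrite Et -!aut_mulE mulgV.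
(* Products of permutations apply the left factor first, products of tree automorphisms the right
   one. *)
exists (t^-1 * s)%g => [|i]; first by rewrite groupM ?groupV.
by rewrite !aut_mulE -{1}(permKV t i) EV Es permM.
Qed.

Lemma recAut_locally_cyclic Q (out : Q -> {perm 'I_d}) next q :
  (forall q', out q' \in <[rot_perm d]>%g) -> locally_cyclic (recAut out next q).
Proof.
move=> outR u; exists (out (foldl next q u)) => //= i.
by elim: u q => [|j u IHu] q //=; rewrite IHu.
Qed.

Lemma sec_mem (H : {pred treeAut d}) x i y : x \in H -> sends x i i y -> y \in sec H i.
Proof. by move=> xH xy; apply/asboolP; exists x. Qed.

Variable S : seq (treeAut d).
Local Notation G := (gen S).

Lemma side_mem h i j x :
  h \in G -> sends h i i x -> sends h j j 1%g -> x \in side S i j.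
Proof. by move=> hG hi hj; apply/asboolP; exists h. Qed.

Definition cyclically_homogeneous :=
  [/\ forall g, g \in G -> locally_cyclic g,
      separately_transitive S & level_transitive S].

(** The check on [side] may assume that [side] is normalized, which follows from the other
    hypotheses; this allows commutators to be formed inside [side]. *)
Lemma branching_criterion (a : treeAut d) (ks : seq (treeAut d)) i0 j0 :
  (forall g, g \in S -> locally_cyclic g) ->
  a \in G -> (forall i, sends a i (ordS i) 1%g) ->
  (forall g, g \in S -> exists i, g \in sec G i) ->
  {subset ks <= G} ->
  (exists2 k, k \in ks & forall i, k [:: i] = [:: ordS i]) ->
  (forall H : {pred treeAut d}, normalized S H -> {subset ks <= H} ->
    forall k, k \in ks -> exists i, k \in sec H i) ->
  ((forall i j, normalized S (side S i j)) -> forall k, k \in ks ->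
    (exists i, k \in sec (side S i0 j0) i) /\
    (exists i, k \in sec (side S j0 i0) i)) ->
  (exists h x y, [/\ h \in G, sends h i0 i0 x, sends h j0 j0 y,
     forall i, x [:: i] = [:: ordS i] & forall i, y [:: i] = [:: i]]) ->
  (exists h x y, [/\ h \in G, sends h i0 i0 x, sends h j0 j0 y,
     forall i, x [:: i] = [:: i] & forall i, y [:: i] = [:: ordS i]]) ->
  (forall i j, i != j -> exists n,
    (i, j) = (iter n (@ordS d) i0, iter n (@ordS d) j0) \/
    (i, j) = (iter n (@ordS d) j0, iter n (@ordS d) i0)) ->
  cyclically_homogeneous.
Proof.
move=> SC aG ea Srep ksG ks_rot ks_sec ks_side rl rr i0j0.
have GC g : g \in G -> locally_cyclic g.
  move=> gG; suff /asboolP : g \in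
    ((fun g => `[< locally_cyclic g >]) : {pred treeAut d}) by [].
  move: g gG; apply: gen_min => [|g gS]; first exact: locally_cyclic_closed.
  exact/asboolP/SC.
have drot : exists2 a, a \in G & forall i, sends a i (ordS i) 1%g by exists a.
have lfree g i : g \in G -> g [:: i] = [:: i] -> forall j, g [:: j] = [:: j].
  move=> /GC/(_ [::])[s sR /= Es]; rewrite aut_nil in Es.
  by rewrite Es => -[si] j; rewrite Es (rot_perm_free j sR si).
have {}ks_side := ks_side (side_normalized drot Srep lfree).
split=> //; last exact (gen_level_transitive drot Srep ks_rot ks_sec ksG).
exact (gen_separately_transitive drot Srep ks_rot ks_sec lfree ks_side rl rr i0j0).
Qed.

End Criterion.

(** Stated with an equation for the section, and with the factor that acts first as first premise,
    so that [solve_sends] computes letters and sections by unification. *)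
Lemma sends_comp d (x x' y y' z : treeAut d) i j k :
  sends x' i j y' -> sends x j k y -> (y * y')%g = z -> sends (x * x')%g i k z.
Proof. by move=> xy' xy <-; exact: sendsM xy xy'. Qed.

Lemma sends_inv d (x y z : treeAut d) i j :
  sends x i j y -> (y^-1)%g = z -> sends x^-1%g j i z.
Proof. by move=> xy <-; exact: sendsV. Qed.

Ltac group_simpl := rewrite
  ?(mulg1, mul1g, invg1, mulgV, mulVg, mulgA, invgK, mulgK, mulgKV).
Ltac solve_sends :=
  lazymatch goal with
  | |- sends (_ * _)%g _ _ _ =>
      eapply sends_comp; [solve_sends | solve_sends | group_simpl; reflexivity]
  | |- sends (_^-1)%g _ _ _ =>
      eapply sends_inv; [solve_sends | group_simpl; reflexivity]
  | _ => eassumption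
  end.

Definition o20 : 'I_2 := @Ordinal 2 0 isT.
Definition o21 : 'I_2 := @Ordinal 2 1 isT.
Definition o30 : 'I_3 := @Ordinal 3 0 isT.
Definition o31 : 'I_3 := @Ordinal 3 1 isT.
Definition o32 : 'I_3 := @Ordinal 3 2 isT.

Lemma ord2P (i : 'I_2) : i = o20 \/ i = o21.
Proof. by case: i => [[|[|]]] // p; [left|right]; apply: val_inj. Qed.
Lemma ord3P (i : 'I_3) : [\/ i = o30, i = o31 | i = o32].
Proof.
by case: i => [[|[|[|]]]] // p; [apply: Or31|apply: Or32|apply: Or33]; apply: val_inj.
Qed.

(** * The five groups *)

Lemma pairs2 (i j : 'I_2) : i != j -> exists n,
  (i, j) = (iter n (@ordS 2) o20, iter n (@ordS 2) o21) \/
  (i, j) = (iter n (@ordS 2) o21, iter n (@ordS 2) o20).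
Proof.
by case: (ord2P i) => ->; case: (ord2P j) => -> // _; exists 0; [left|right].
Qed.

Lemma pairs3 (i j : 'I_3) : i != j -> exists n,
  (i, j) = (iter n (@ordS 3) o30, iter n (@ordS 3) o31) \/
  (i, j) = (iter n (@ordS 3) o31, iter n (@ordS 3) o30).
Proof.
case: (ord3P i) => ->; case: (ord3P j) => -> // _;
  [exists 0; left|exists 2; right|exists 0; right|exists 1; left
  |exists 2; left|exists 1; right]; congr pair; exact: val_inj.
Qed.

Lemma sends_a2 (a : treeAut 2) : (forall i, sends a i (ordS i) 1%g) ->
  sends a o20 o21 1%g /\ sends a o21 o20 1%g.
Proof.
move=> ea; split; first by have := ea o20; rewrite (_ : ordS _ = o21) //; exact: val_inj.
by have := ea o21; rewrite (_ : ordS _ = o20) //; exact: val_inj.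
Qed.

Lemma sends_a3 (a : treeAut 3) : (forall i, sends a i (ordS i) 1%g) ->
  [/\ sends a o30 o31 1%g, sends a o31 o32 1%g & sends a o32 o30 1%g].
Proof.
move=> ea; split.
- by have := ea o30; rewrite (_ : ordS _ = o31) //; exact: val_inj.
- by have := ea o31; rewrite (_ : ordS _ = o32) //; exact: val_inj.
- by have := ea o32; rewrite (_ : ordS _ = o30) //; exact: val_inj.
Qed.

(** * The two groups on the binary tree *)

Section Binary.
Variables (a b c e : treeAut 2).
Local Notation S := [:: a; b; c; e].
Hypothesis S_cyc : forall g, g \in S -> locally_cyclic g.
Hypothesis ea : forall i, sends a i (ordS i) 1%g.

Let aG : a \in gen S. Proof. by apply: gen_sub; rewrite !inE eqxx. Qed.
Let bG : b \in gen S. Proof. by apply: gen_sub; rewrite !inE eqxx ?orbT. Qed.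
Let cG : c \in gen S. Proof. by apply: gen_sub; rewrite !inE eqxx ?orbT. Qed.
Let eG : e \in gen S. Proof. by apply: gen_sub; rewrite !inE eqxx ?orbT. Qed.
Let a0 : sends a o20 o21 1%g. Proof. exact: (sends_a2 ea).1. Qed.
Let a1 : sends a o21 o20 1%g. Proof. exact: (sends_a2 ea).2. Qed.

(** Here [ks] is [a, c], the two sections of [b]; and [b] lies in both sides because
    [psi e = (1, b)] and [psi (a e a^-1) = (b, 1)]. If [H] contains [a] and [c], then [a] is a
    section of [c], and the commutator of [a] and [b] has section [c a^-1] at the first letter. *)
Lemma frakG_rec_homogeneous :
  sends b o20 o20 a -> sends b o21 o21 c ->
  sends c o20 o20 a -> sends c o21 o21 e ->
  sends e o20 o20 1%g -> sends e o21 o21 b -> cyclically_homogeneous S.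
Proof.
move=> b0 b1 c0 c1 e0 e1.
have c_fix i : c [:: i] = [:: i].
  by case: (ord2P i) => ->; [exact: sends_head c0 | exact: sends_head c1].
have ks_b i j : b \in side S i j -> forall k, k \in [:: a; c] ->
    exists l, k \in sec (side S i j) l.
  move=> bN k; rewrite !(in_cons, in_nil, orbF) => /orP[] /eqP->.
    by exists o20; exact: sec_mem bN b0.
  by exists o21; exact: sec_mem bN b1.
apply: (@branching_criterion _ S a [:: a; c] o20 o21) => //.
- move=> g; rewrite !(in_cons, in_nil, orbF) => /or4P[] /eqP->.
  + by exists o20; exact: sec_mem bG b0.
  + by exists o21; exact: sec_mem eG e1.
  + by exists o21; exact: sec_mem bG b1.
  + by exists o21; exact: sec_mem cG c1.
- by move=> k; rewrite !(in_cons, in_nil, orbF) => /orP[] /eqP->.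
- by exists a; rewrite ?inE ?eqxx // => i; exact: sends_head (ea i).
- move=> H nH ksH; have aH : a \in H by apply: ksH; rewrite inE eqxx.
  have cH : c \in H by apply: ksH; rewrite !inE eqxx orbT.
  have sa : a \in sec H o20 by exact: sec_mem cH c0.
  move=> k; rewrite !(in_cons, in_nil, orbF) => /orP[] /eqP->; exists o20 => //.
  have abH : (a * (b * a^-1 * b^-1))%g \in H.
    by rewrite (normalizedM nH) // nH.2 // (normalizedV nH).
  have sca : (c * a^-1)%g \in sec H o20 by apply: sec_mem abH _; solve_sends.
  by rewrite -(mulgKV a c) (group_closedM (sec_closed o20 nH.1)).
- have bN1 : b \in side S o20 o21.
    by apply: (@side_mem _ _ (a * e * a^-1)%g); [rewrite !genM ?genV | solve_sends ..].
  have bN2 : b \in side S o21 o20 by exact: (side_mem eG).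
  by move=> _ k kks; split; exact: ks_b kks.
- exists b, a, c; split=> // i; exact: sends_head (ea i).
- exists (a * b * a^-1)%g, c, a; split=> //; last by move=> i; exact: sends_head (ea i).
  + by rewrite !genM ?genV.
  + by solve_sends.
  + by solve_sends.
- exact: pairs2.
Qed.

(** Here [ks] is [a, b]: [a] is a section of [b], and [b] is a section both of [e] and of the
    commutator of [a] and [e]. The elements [e], [c] and their conjugates by [a] put [b] and [e] in
    both sides. *)
Lemma frakGtilde_rec_homogeneous :
  sends b o20 o20 a -> sends b o21 o21 c ->
  sends c o20 o20 1%g -> sends c o21 o21 e ->
  sends e o20 o20 1%g -> sends e o21 o21 b -> cyclically_homogeneous S.
Proof.
move=> b0 b1 c0 c1 e0 e1.
have c_fix i : c [:: i] = [:: i].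
  by case: (ord2P i) => ->; [exact: sends_head c0 | exact: sends_head c1].
have ks_be i j : b \in side S i j -> e \in side S i j -> forall k, k \in [:: a; b] ->
    exists l, k \in sec (side S i j) l.
  move=> bN eN k; rewrite !(in_cons, in_nil, orbF) => /orP[] /eqP->.
    by exists o20; exact: sec_mem bN b0.
  by exists o21; exact: sec_mem eN e1.
apply: (@branching_criterion _ S a [:: a; b] o20 o21) => //.
- move=> g; rewrite !(in_cons, in_nil, orbF) => /or4P[] /eqP->.
  + by exists o20; exact: sec_mem bG b0.
  + by exists o21; exact: sec_mem eG e1.
  + by exists o21; exact: sec_mem bG b1.
  + by exists o21; exact: sec_mem cG c1.
- by move=> k; rewrite !(in_cons, in_nil, orbF) => /orP[] /eqP->.
- by exists a; rewrite ?inE ?eqxx // => i; exact: sends_head (ea i).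
- move=> H nH ksH; have aH : a \in H by apply: ksH; rewrite inE eqxx.
  have bH : b \in H by apply: ksH; rewrite !inE eqxx orbT.
  have aeH : (a * (e * a^-1 * e^-1))%g \in H.
    by rewrite (normalizedM nH) // nH.2 // (normalizedV nH).
  move=> k; rewrite !(in_cons, in_nil, orbF) => /orP[] /eqP->; exists o20.
    exact: sec_mem bH b0.
  by apply: sec_mem aeH _; solve_sends.
- have bN1 : b \in side S o20 o21.
    by apply: (@side_mem _ _ (a * e * a^-1)%g); [rewrite !genM ?genV | solve_sends ..].
  have eN1 : e \in side S o20 o21.
    by apply: (@side_mem _ _ (a * c * a^-1)%g); [rewrite !genM ?genV | solve_sends ..].
  have bN2 : b \in side S o21 o20 by exact: (side_mem eG).
  have eN2 : e \in side S o21 o20 by exact: (side_mem cG).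
  by move=> _ k kks; split; exact: ks_be kks.
- exists b, a, c; split=> // i; exact: sends_head (ea i).
- exists (a * b * a^-1)%g, c, a; split=> //; last by move=> i; exact: sends_head (ea i).
  + by rewrite !genM ?genV.
  + by solve_sends.
  + by solve_sends.
- exact: pairs2.
Qed.
End Binary.

(* Conjugation by [a] rotates the coordinates: psi (a s a^-1) = (s, s_0, s_1)  *)
(* when psi s = (s_0, s_1, s). For the letters 0 and 1, the commutators of [s] *)
(* with a s a^-1 and with a^2 s a^-2 are trivial below one of the two letters. *)
Section Ternary.
Variables (a s : treeAut 3).
Local Notation S := [:: a; s].
Hypothesis S_cyc : forall g, g \in S -> locally_cyclic g.
Hypothesis ea : forall i, sends a i (ordS i) 1%g.
Hypothesis s2 : sends s o32 o32 s.

Let aG : a \in gen S. Proof. by apply: gen_sub; rewrite !inE eqxx. Qed.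
Let sG : s \in gen S. Proof. by apply: gen_sub; rewrite !inE eqxx ?orbT. Qed.
Let a0 : sends a o30 o31 1%g. Proof. by case: (sends_a3 ea). Qed.
Let a1 : sends a o31 o32 1%g. Proof. by case: (sends_a3 ea). Qed.
Let a2 : sends a o32 o30 1%g. Proof. by case: (sends_a3 ea). Qed.

Let a_rot i : a [:: i] = [:: ordS i].
Proof. exact: sends_head (ea i). Qed.

Let s_fix x y : sends s o30 o30 x -> sends s o31 o31 y ->
  forall i, s [:: i] = [:: i].
Proof.
by move=> s0 s1 i; case: (ord3P i) => ->;
  [exact: sends_head s0 | exact: sends_head s1 | exact: sends_head s2].
Qed.

(** Since [psi s = (a, 1, s)] and [psi (a^2 s a^-2) = (1, s, a)], one side contains [a] and the
    other [s]. On the side of [a], normality yields the commutator of [a] and [s], which has section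
    [a] at [o31] and whose inverse has section [s] at [o32]. *)
Lemma Gamma_rec_homogeneous :
  sends s o30 o30 a -> sends s o31 o31 1%g -> cyclically_homogeneous S.
Proof.
move=> s0 s1.
have secP (H : {pred treeAut 3}) : s \in H -> forall k, k \in S -> exists i, k \in sec H i.
  move=> sH k; rewrite !(in_cons, in_nil, orbF) => /orP[] /eqP->.
    by exists o30; exact: sec_mem sH s0.
  by exists o32; exact: sec_mem sH s2.
apply: (@branching_criterion _ S a S o30 o31) => //.
- exact: secP.
- exact: gen_sub.
- by exists a; rewrite ?inE ?eqxx.
- by move=> H nH ksH; apply: secP; apply: ksH; rewrite !inE eqxx orbT.
- have sN : s \in side S o31 o30.
    by apply: (@side_mem _ _ (a * (a * s * a^-1) * a^-1)%g);
      [rewrite !(genM, genV) | solve_sends ..].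
  have aN : a \in side S o30 o31 by exact: side_mem sG s0 s1.
  move=> nN k kS; split; last exact: secP sN k kS.
  have zN : (a * (s * a^-1 * s^-1))%g \in side S o30 o31.
    by rewrite (normalizedM (nN _ _)) // (nN _ _).2 // (normalizedV (nN _ _)).
  have zVN : ((a * (s * a^-1 * s^-1))^-1)%g \in side S o30 o31.
    exact: normalizedV zN.
  move: kS; rewrite !(in_cons, in_nil, orbF) => /orP[] /eqP->.
    by exists o31; apply: sec_mem zN _; solve_sends.
  by exists o32; apply: sec_mem zVN _; solve_sends.
- by exists s, a, 1%g; split.
- exists (a * s * a^-1)%g, s, a; split=> //; last exact: s_fix s0 s1.
  + by rewrite !genM ?genV.
  + by solve_sends.
  + by solve_sends.
- exact: pairs3.
Qed.

(** The single element [k = a s^-1] suffices: it rotates level 1 and is the section at [o32] of the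
    commutator of [a] and [s]. That commutator is a product of [k] and a conjugate of [k^-1], and
    lies in both sides. *)
Lemma Gambar_rec_homogeneous :
  sends s o30 o30 a -> sends s o31 o31 a -> cyclically_homogeneous S.
Proof.
move=> s0 s1.
have s_fixes i : s [:: i] = [:: i] by exact: s_fix s0 s1 i.
pose k := (a * s^-1)%g.
have secP (H : {pred treeAut 3}) : (a * s * a^-1 * s^-1)%g \in H ->
    forall l, l \in [:: k] -> exists i, l \in sec H i.
  by move=> zH l; rewrite mem_seq1 => /eqP->; exists o32; apply: sec_mem zH _; solve_sends.
apply: (@branching_criterion _ S a [:: k] o30 o31) => //.
- move=> g; rewrite !(in_cons, in_nil, orbF) => /orP[] /eqP->.
    by exists o30; exact: sec_mem sG s0.
  by exists o32; exact: sec_mem sG s2.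
- by move=> l; rewrite mem_seq1 => /eqP->; rewrite genM ?genV.
- exists k; rewrite ?inE // => i.
  by rewrite aut_mulE (headV (s_fixes i)) a_rot.
- move=> H nH ksH; apply: secP; have kH : k \in H by apply: ksH; rewrite inE.
  have -> : (a * s * a^-1 * s^-1 = (a * k^-1 * a^-1) * k)%g.
    by rewrite /k invgM invgK !mulgA mulgKV.
  by rewrite (normalizedM nH) // nH.2 // (normalizedV nH).
- move=> _ l lk; split; apply: secP l lk.
    apply: (@side_mem _ _ (s * (a * s * a^-1) * s^-1 * (a * s^-1 * a^-1))%g);
      [by rewrite !(genM, genV) | solve_sends ..].
  apply: (@side_mem _ _ (s * (a * (a * s * a^-1) * a^-1) * s^-1
      * (a * (a * s^-1 * a^-1) * a^-1))%g);
    [by rewrite !(genM, genV) | solve_sends ..].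
- exists (a * (a * s * a^-1) * a^-1)%g, a, s.
  by split=> //; [rewrite !(genM, genV) | solve_sends ..].
- exists (a * s * a^-1)%g, s, a.
  by split=> //; [rewrite !(genM, genV) | solve_sends ..].
- exact: pairs3.
Qed.

Lemma rot3_cube : (a * a * a = 1)%g.
Proof.
apply: treeAut_ext => -[|i w]; first by rewrite !aut_nil.
rewrite !aut_mulE !ea; congr cons.
by case: (ord3P i) => ->; apply: val_inj.
Qed.

(** Both sides contain the commutator [z] of [a] and [s]. The section of [z^-1] at [o31] is
    [a^-2 = a]; that of [z (a^2 z^-1 a^-2)] at [o30] is [s a^-3 = s]. *)
Lemma Gambarbar_rec_homogeneous :
  sends s o30 o30 a -> sends s o31 o31 a^-1%g -> cyclically_homogeneous S.
Proof.
move=> s0 s1.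
have s_fixes i : s [:: i] = [:: i] by exact: s_fix s0 s1 i.
have aVV : (a^-1 * a^-1)%g = a 
  by rewrite -invgM; apply: (@mulgI _ (a * a)%g); rewrite mulgV rot3_cube.
have secS (H : {pred treeAut 3}) : s \in H -> forall k, k \in S -> exists i, k \in sec H i.
  move=> sH k; rewrite !(in_cons, in_nil, orbF) => /orP[] /eqP->.
    by exists o30; exact: sec_mem sH s0.
  by exists o32; exact: sec_mem sH s2.
have secP (H : {pred treeAut 3}) : normalized S H -> (a * s * a^-1 * s^-1)%g \in H ->
    forall l, l \in S -> exists i, l \in sec H i.
  move=> nH zH.
  have zVH : (s * a * s^-1 * a^-1)%g \in H.
    by have := normalizedV nH zH; rewrite !invgM !invgK !mulgA.
  have tH : (a * s * a^-1 * s^-1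
      * (a * (a * (s * a * s^-1 * a^-1) * a^-1) * a^-1))%g \in H.
    by rewrite (normalizedM nH) // !nH.2.
  move=> l; rewrite !(in_cons, in_nil, orbF) => /orP[] /eqP->.
    by exists o31; rewrite -aVV; apply: sec_mem zVH _; solve_sends.
  have E : (s * a^-1 * a^-1 * a^-1)%g = s by rewrite -!mulgA aVV mulVg mulg1.
  by exists o30; rewrite -E; apply: sec_mem tH _; solve_sends.
apply: (@branching_criterion _ S a S o30 o31) => //.
- exact: secS.
- exact: gen_sub.
- by exists a; rewrite ?inE ?eqxx.
- by move=> H nH ksH; apply: secS; apply: ksH; rewrite !inE eqxx orbT.
- move=> nN l lk; split; apply: secP l lk => //.
    apply: (@side_mem _ _ (s * (a * s * a^-1) * s^-1 * (a * s^-1 * a^-1))%g);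
      [by rewrite !(genM, genV) | solve_sends ..].
  have zN : (a^-1 * s * a * s^-1)%g \in side S o31 o30.
    apply: (@side_mem _ _ (s * (a * (a * s * a^-1) * a^-1) * s^-1
      * (a * (a * s^-1 * a^-1) * a^-1))%g);
      [by rewrite !(genM, genV) | solve_sends ..].
  have := (nN o31 o30).2 _ _ aG (normalizedV (nN o31 o30) zN).
  by rewrite !invgM !invgK !mulgA mulgK.
- exists (a * (a * s^-1 * a^-1) * a^-1)%g, a, s^-1%g.
  split=> // [|||i]; [by rewrite !(genM, genV) | by solve_sends ..|].
  by apply: headV.
- exists (a * s * a^-1)%g, s, a.
  by split=> //; [rewrite !(genM, genV) | solve_sends ..].
- exact: pairs3.
Qed.
End Ternary.

(** * Fourier analysis on words *)

Section Fourier.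
Local Open Scope ring_scope.
Variables (F : numFieldType) (d' : nat) (omega : F).
Local Notation d := d'.+1.
Hypothesis omega_prim : d.-primitive_root omega.

Definition chi (e : nat) (i : 'I_d) : F := omega ^+ (e * i).

Lemma omega_neq0 : omega != 0.
Proof.
apply/eqP => w0; have := prim_expr_order omega_prim.
by rewrite w0 expr0n /= => /eqP; rewrite eq_sym oner_eq0.
Qed.

Lemma chi_neq0 e i : chi e i != 0.
Proof. by rewrite expf_neq0 ?omega_neq0. Qed.

Lemma chi0 e : chi e ord0 = 1.
Proof. by rewrite /chi muln0. Qed.

Lemma chi0l i : chi 0 i = 1.
Proof. by []. Qed.

Lemma chi_ordS e i : chi e (ordS i) = omega ^+ e * chi e i.
Proof.
rewrite /chi /= -exprD -(prim_expr_mod omega_prim) modnMmr.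
by rewrite (prim_expr_mod omega_prim) mulnS.
Qed.

Lemma chi_rot e s i : s \in <[rot_perm d]>%g -> chi e (s i) = chi e i * chi e (s ord0).
Proof.
case/cycleP=> m ->.
have E j : chi e ((rot_perm d ^+ m)%g j) = omega ^+ (e * m) * chi e j.
  elim: m => [|m IHm]; first by rewrite expg0 perm1 muln0 mul1r.
  by rewrite expgSr permM rot_permE chi_ordS IHm mulrA -exprD mulnS.
by rewrite !E chi0 mulr1 mulrC.
Qed.

Lemma sum_root_unity (z : F) : z ^+ d = 1 -> z != 1 -> \sum_(i < d) z ^+ i = 0.
Proof.
move=> zd z1; have := subrX1 z d; rewrite zd subrr => /esym/eqP.
by rewrite mulf_eq0 subr_eq0 (negPf z1) => /eqP.
Qed.

Lemma chi_orthogonal (e e' : 'I_d) :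
  \sum_i chi e i / chi e' i = if e == e' then d%:R else 0.
Proof.
have E i : chi e i / chi e' i = (omega ^+ e / omega ^+ e') ^+ i.
  by rewrite expr_div_n -!exprM.
under eq_bigr do rewrite E.
have w0 := expf_neq0 e' omega_neq0.
have [->|ne] := eqVneq e e'.
  by under eq_bigr do rewrite divff // expr1n; rewrite sumr_const card_ord.
apply: sum_root_unity.
  have wd k : (omega ^+ k) ^+ d = 1.
    by rewrite -exprM mulnC exprM (prim_expr_order omega_prim) expr1n.
  by rewrite expr_div_n !wd divr1.
apply: contra ne => /eqP/(congr1 ( *%R^~ (omega ^+ e'))).
rewrite mulfVK // mul1r => /eqP.
by rewrite (eq_prim_root_expr omega_prim) !modn_small.
Qed.

Lemma chiC (e i : 'I_d) : chi e i = chi i e.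
Proof. by rewrite /chi mulnC. Qed.

Let d_neq0 : d%:R != 0 :> F. Proof. by rewrite pnatr_eq0. Qed.

Lemma fourier1_exists (p : 'I_d -> F) :
  exists c : 'I_d -> F, forall i, p i = \sum_(e : 'I_d) chi e i * c e.
Proof.
exists (fun e => d%:R^-1 * \sum_j p j / chi e j) => i.
transitivity (d%:R^-1 * \sum_j p j * \sum_(e : 'I_d) chi i e / chi j e).
  rewrite (bigD1 i) //= chi_orthogonal eqxx big1 => [|j ji].
    by rewrite addr0 mulrC mulfK.
  by rewrite chi_orthogonal eq_sym (negPf ji) mulr0.
under eq_bigr do rewrite mulr_sumr.
rewrite exchange_big mulr_sumr; apply: eq_bigr => e _.
rewrite mulrCA !mulr_sumr; apply: eq_bigr => j _.
by rewrite !(chiC e); congr (_ * _); rewrite mulrCA.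
Qed.

Lemma fourier1_uniq (c : 'I_d -> F) :
  (forall i, \sum_(e : 'I_d) chi e i * c e = 0) -> forall e, c e = 0.
Proof.
move=> c0 e0; apply: (mulfI d_neq0); rewrite mulr0.
transitivity (\sum_e c e * \sum_i chi e i / chi e0 i).
  rewrite (bigD1 e0) //= chi_orthogonal eqxx big1 => [|j ji].
    by rewrite addr0 mulrC.
  by rewrite chi_orthogonal (negPf ji) mulr0.
under eq_bigr do rewrite mulr_sumr.
rewrite exchange_big big1 // => i _.
under eq_bigr do rewrite mulrA (mulrC (c _)).
by rewrite -mulr_suml c0 mul0r.
Qed.

Definition fourier_sum m c (q : nat -> nat -> word d -> F) (w : word d) :=
  c + \sum_(k < m) \sum_(e < d') chi e.+1 (nth ord0 w k) * q e k (take k w).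

Lemma fourier_sum_rcons m c q u i : size u = m ->
  fourier_sum m.+1 c q (rcons u i) =
  \sum_(e < d) chi e i * (if val e is e'.+1 then q e' m u else fourier_sum m c q u).
Proof.
move=> sz_u; rewrite /fourier_sum big_ord_recr big_ord_recl /= addrA.
rewrite -cats1 nth_cat sz_u ltnn subnn /= chi0l mul1r.
congr (_ + _).
  congr (_ + _); apply: eq_bigr => k _; apply: eq_bigr => e _.
  by rewrite nth_cat sz_u ltn_ord takel_cat // sz_u ltnW.
by apply: eq_bigr => e _; rewrite take_size_cat.
Qed.

Lemma fourier_exists m (p : word d -> F) : exists c q,
  forall w, size w = m -> p w = fourier_sum m c q w.
Proof.
elim: m p => [|m IHm] p.
  exists (p [::]), (fun _ _ _ => 0) => w /size0nil ->.
  by rewrite /fourier_sum big_ord0 addr0.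
have /boolp.choice[ph phE] : forall u, exists c : 'I_d -> F, forall i,
    p (rcons u i) = \sum_(e : 'I_d) chi e i * c e.
  by move=> u; exact: fourier1_exists.
have [c [q qE]] := IHm (ph^~ ord0).
exists c, (fun e k u => if k == m then ph u (inord e.+1) else q e k u) => w.
case/lastP: w => // u i; rewrite size_rcons => -[sz_u].
rewrite fourier_sum_rcons // phE; apply: eq_bigr => e _; congr (_ * _).
case: e => -[|e] lt_ed /=; last first.
  by rewrite eqxx; congr ph; apply: val_inj; rewrite /= inordK.
rewrite (_ : Ordinal _ = ord0); last exact: val_inj.
rewrite qE // /fourier_sum; congr (_ + _).
by apply: eq_bigr => k _; apply: eq_bigr => e _; rewrite ltn_eqF.
Qed.

Lemma fourier_uniq m c q : (forall w, size w = m -> fourier_sum m c q w = 0) ->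
  c = 0 /\ forall e k u, (k < m)%N -> (e < d')%N -> size u = k -> q e k u = 0.
Proof.
elim: m => [|m IHm] E.
  by have := E [::] erefl; rewrite /fourier_sum big_ord0 addr0.
have E1 u : size u = m -> forall e : 'I_d,
    (if val e is e'.+1 then q e' m u else fourier_sum m c q u) = 0.
  move=> sz_u; apply: (@fourier1_uniq
    (fun e => if val e is e'.+1 then q e' m u else fourier_sum m c q u)) => i.
  by rewrite -fourier_sum_rcons // E // size_rcons sz_u.
have [c0 q0] := IHm (fun u sz_u => E1 u sz_u ord0).
split=> // e k u; rewrite ltnS leq_eqVlt => /orP[/eqP->|]; last exact: q0.
move=> lt_ed sz_u; have lt_ed' : (e.+1 < d)%N by [].
exact: E1 u sz_u (Ordinal lt_ed').
Qed.

End Fourier.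

(** * Decomposition of the functions on a level *)

Lemma map_nseq_cst (T U : Type) (s : seq T) (y : U) :
  [seq y | _ <- s] = nseq (size s) y.
Proof. by elim: s => //= _ s ->. Qed.

Section FiniteIndex.
Local Open Scope ring_scope.
Variables (F : fieldType) (G : groupType) (V : lmodType F).
Variable rho : representation G V.

Lemma subrep0 W : subrep rho W -> 0 \in W.
Proof. by case=> /GRing.submod_closed_semi[[]]. Qed.

Lemma subrepD W f h : subrep rho W -> f \in W -> h \in W -> f + h \in W.
Proof. by case=> /GRing.submod_closed_semi[[_ WD] _] _; exact: WD. Qed.

Lemma subrepZ W c f : subrep rho W -> f \in W -> c *: f \in W.
Proof. by case=> /GRing.submod_closed_semi[_ WZ] _; exact: WZ. Qed.

Lemma subrep_sum W (J : Type) (r : seq J) (P : pred J) (f : J -> V) :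
  subrep rho W -> (forall j, P j -> f j \in W) ->
  \sum_(j <- r | P j) f j \in W.
Proof.
move=> sW fW; elim/big_ind: _ => //; first exact: subrep0.
by move=> x y; exact: subrepD.
Qed.

Lemma has_dim_basis (W : {pred V}) (J : finType) (b : J -> V) (co : J -> V -> F) :
  (forall j, b j \in W) ->
  (forall v, v \in W -> v = \sum_j co j v *: b j) ->
  (forall (c : J -> F) j, co j (\sum_i c i *: b i) = c j) ->
  has_dim W #|J|.
Proof.
move=> bW span coE; exists (fun i => b (enum_val i)); split=> // v vW.
exists [ffun i => co (enum_val i) v]; split.
  rewrite {1}(span v vW) (reindex (@enum_val J J)) /=; last first.
    by exists enum_rank => x _; rewrite ?enum_valK ?enum_rankK.
  by apply: eq_bigr => i _; rewrite ffunE.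
move=> c vE; apply/ffunP => i; rewrite ffunE.
have -> : v = \sum_j c (enum_rank j) *: b j.
  rewrite {1}vE (reindex (@enum_val J J)) /=; last first.
    by exists enum_rank => x _; rewrite ?enum_valK ?enum_rankK.
  by apply: eq_bigr => j _; rewrite enum_valK.
by rewrite (coE (fun j => c (enum_rank j))) enum_valK.
Qed.

Lemma irreducible_decomposition_fin (I : finType) (W : I -> {pred V})
    (deg : I -> nat) m degs :
  m = #|I| ->
  (forall i, irreducible_subrep rho (W i)) ->
  (forall v, exists2 w : I -> V, forall i, w i \in W i & v = \sum_i w i) ->
  (forall w : I -> V, (forall i, w i \in W i) -> \sum_i w i = 0 -> forall i, w i = 0) ->
  (forall i, has_dim (W i) (deg i)) ->
  perm_eq [seq deg i | i <- enum I] degs ->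
  irreducible_decomposition rho m degs.
Proof.
move=> -> Wirr Wex Wuniq Wdim Wdeg.
exists (fun i => W (enum_val i)), (fun i => deg (enum_val i)); split=> //.
- move=> v; have [w wW vE] := Wex v.
  have sumE (x : I -> V) : \sum_i x i = \sum_(i < #|I|) x (enum_val i).
    rewrite (reindex (@enum_val I I)) //=.
    by exists enum_rank => x' _; rewrite ?enum_valK ?enum_rankK.
  exists [ffun i => w (enum_val i)]; split.
    split=> [i|]; first by rewrite ffunE.
    by rewrite vE sumE; apply: eq_bigr => i _; rewrite ffunE.
  move=> w' [w'W vE']; apply/ffunP => i; rewrite ffunE; apply/eqP.
  rewrite -subr_eq0; apply/eqP.
  have := Wuniq (fun j => w j - w' (enum_rank j)) _ _ (enum_val i).
  rewrite enum_valK; apply.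
    move=> j; have [sW _ _] := Wirr j.
    rewrite -scaleN1r; apply: (subrepD sW) => //; apply: (subrepZ _ sW).
    by have := w'W (enum_rank j); rewrite enum_rankK.
  rewrite sumrB -vE sumE vE' -sumrB big1 // => j _.
  by rewrite enum_valK subrr.
- apply: perm_trans Wdeg; rewrite (map_comp deg) perm_map //.
  apply: uniq_perm; last move=> i.
  - by rewrite map_inj_uniq ?enum_uniq //; exact: enum_val_inj.
  - exact: enum_uniq.
  rewrite mem_enum; apply/mapP; exists (enum_rank i); first by rewrite mem_enum.
  by rewrite enum_rankK.
Qed.

End FiniteIndex.

Section TreeRepresentation.
Local Open Scope ring_scope.
Variables (F : numFieldType) (d' n : nat) (omega : F).
Local Notation d := d'.+1.
Hypothesis omega_prim : d.-primitive_root omega.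
Variable S : seq (treeAut d).
Hypothesis S_hom : cyclically_homogeneous S.
Variables (V : lmodType F) (rho : representation (genGroup S) V).
Implicit Types (f h : V) (g : genGroup S) (u w : word d).

(* [V] stands for the functions on level [n]; only the values of [ev f] at     *)
(* words of length [n] matter.                                                 *)
Variable ev : V -> word d -> F.
Hypothesis ev_lin : forall c f h w, ev (c *: f + h) w = c * ev f w + ev h w.
Hypothesis ev_inj : forall f h,
  (forall w, size w = n -> ev f w = ev h w) -> f = h.
Hypothesis ev_surj : forall p : word d -> F,
  exists f, forall w, size w = n -> ev f w = p w.
Hypothesis ev_act : forall g f w, size w = n -> ev (rho g f) (val g w) = ev f w.

Local Notation chi := (chi omega).
Local Notation letter w k := (nth (@ord0 d') w k).

Lemma ev0 w : ev 0 w = 0.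
Proof.
have := ev_lin 1 0 0 w; rewrite scale1r addr0 mul1r => /eqP.
by rewrite -subr_eq0 opprD addrA subrr add0r oppr_eq0 => /eqP.
Qed.

Lemma evD f h w : ev (f + h) w = ev f w + ev h w.
Proof. by rewrite -{1}[f]scale1r ev_lin mul1r. Qed.

Lemma evZ c f w : ev (c *: f) w = c * ev f w.
Proof. by rewrite -[c *: f]addr0 ev_lin ev0 addr0. Qed.

Lemma ev_sum (J : Type) (r : seq J) (P : pred J) (f : J -> V) w :
  ev (\sum_(j <- r | P j) f j) w = \sum_(j <- r | P j) ev (f j) w.
Proof. by apply: (big_morph (ev^~ w)); [move=> x y; exact: evD | exact: ev0]. Qed.

Lemma ev_actV g f w : size w = n -> ev (rho g f) w = ev f (val g^-1%g w).
Proof.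
move=> sz_w; rewrite -{1}[w](_ : val g (val g^-1%g w) = w) ?ev_act ?size_aut //.
by rewrite -aut_mulE -valM mulgV.
Qed.

Definition lift p : V := projT1 (cid (ev_surj p)).

Lemma ev_lift p w : size w = n -> ev (lift p) w = p w.
Proof. by rewrite /lift; case: cid => f; exact. Qed.

Definition constants : {pred V} := fun f =>
  `[< exists c, forall w, size w = n -> ev f w = c >].

Definition component e k : {pred V} := fun f =>
  `[< exists q, forall w, size w = n ->
        ev f w = chi e (letter w k) * q (take k w) >].

Lemma constantsP f :
  reflect (exists c, forall w, size w = n -> ev f w = c) (f \in constants).
Proof. exact: asboolP. Qed.

Lemma componentP e k f : reflect (exists q, forall w, size w = n ->
  ev f w = chi e (letter w k) * q (take k w)) (f \in component e k).
Proof. exact: asboolP. Qed.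

Lemma constants_subrep : subrep rho constants.
Proof.
split; first split.
- by apply/constantsP; exists 0 => w _; rewrite ev0.
- move=> c f h /constantsP[a Ea] /constantsP[b Eb]; apply/constantsP.
  by exists (c * a + b) => w sz_w; rewrite ev_lin Ea ?Eb.
- move=> g f /constantsP[a Ea]; apply/constantsP.
  by exists a => w sz_w; rewrite ev_actV // Ea ?size_aut.
Qed.

Lemma constants_irreducible : irreducible_subrep rho constants.
Proof.
split; first exact: constants_subrep.
  exists (lift (fun _ => 1)).
    by apply/constantsP; exists 1 => w sz_w; rewrite ev_lift.
  apply/eqP => /(congr1 (ev^~ (nseq n ord0))).
  by rewrite ev_lift ?size_nseq // ev0 => /eqP; rewrite oner_eq0.
move=> U sU UW; have [|/existsNP[f]] := pselect (forall f, f \in U -> f = 0).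
  by left.
move=> /not_implyP[fU /eqP f0]; right=> h /constantsP[b Eb].
have /constantsP[a Ea] := UW f fU.
have a0 : a != 0.
  apply: contraNneq f0 => a0; apply/eqP; apply: ev_inj => w sz_w.
  by rewrite ev0 Ea.
rewrite (_ : h = (b / a) *: f); first exact: subrepZ sU fU.
by apply: ev_inj => w sz_w; rewrite evZ Ea // Eb // mulfVK.
Qed.

Lemma constants_dim : has_dim constants 1.
Proof.
rewrite -card_unit.
apply: (@has_dim_basis _ _ _ _ (fun=> lift (fun _ => 1)) (fun _ f => ev f (nseq n ord0))).
- by move=> _; apply/constantsP; exists 1 => w sz_w; rewrite ev_lift.
- move=> f /constantsP[a Ea]; apply: ev_inj => w sz_w.
  by rewrite big_const card_unit /= addr0 evZ ev_lift // mulr1 !Ea ?size_nseq.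
- move=> c []; rewrite ev_sum (big_pred1 tt) => [|[]//].
  by rewrite evZ ev_lift ?size_nseq // mulr1.
Qed.

(** The amount by which [g] rotates the children of [u], up to the label of the image vertex: the
    image of the letter 0. *)
Definition cocycle (g : treeAut d) u : 'I_d := last ord0 (g (rcons u ord0)).

Lemma take_letter k w : (k < size w)%N -> take k.+1 w = rcons (take k w) (letter w k).
Proof. by move=> lt_kw; rewrite (take_nth ord0). Qed.

Lemma chi_letter g e k w : (k < size w)%N ->
  chi e (letter (val g w) k) =
  chi e (letter w k) * chi e (cocycle (val g) (take k w)).
Proof.
move=> lt_kw; have [homC _ _] := S_hom.
have [s sR Es] := homC _ (valP g) (take k w).
have := aut_take (val g) k.+1 w; rewrite !take_letter ?size_aut // Es.
rewrite -aut_take => /rcons_inj[<-].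
by rewrite (chi_rot omega_prim e _ sR) /cocycle Es last_rcons.
Qed.

Lemma component_subrep e k : (k < n)%N -> subrep rho (component e k).
Proof.
move=> lt_kn; split; first split.
- by apply/componentP; exists (fun _ => 0) => w _; rewrite ev0 mulr0.
- move=> c f h /componentP[a Ea] /componentP[b Eb]; apply/componentP.
  exists (fun u => c * a u + b u) => w sz_w.
  by rewrite ev_lin Ea ?Eb // mulrDr mulrCA.
- move=> g f /componentP[a Ea]; apply/componentP.
  exists (fun u => chi e (cocycle (val g^-1%g) u) * a (val g^-1%g u)) => w sz_w.
  rewrite ev_actV // Ea ?size_aut // chi_letter ?sz_w // mulrA.
  by rewrite -aut_take.
Qed.

Definition delta e k u : V :=
  lift (fun w => if take k w == u then chi e (letter w k) else 0).

Lemma ev_delta e k u w : size w = n ->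
  ev (delta e k u) w = if take k w == u then chi e (letter w k) else 0.
Proof. exact: ev_lift. Qed.

Lemma delta_component e k u : delta e k u \in component e k.
Proof.
apply/componentP; exists (fun u' => (u' == u)%:R) => w sz_w.
by rewrite ev_delta //; case: ifP; rewrite ?mulr1 ?mulr0.
Qed.

Let ext k u := u ++ nseq (n - k) (@ord0 d').

Let size_ext k u : (k < n)%N -> size u = k -> size (ext k u) = n.
Proof. by move=> /ltnW le_kn sz_u; rewrite size_cat size_nseq sz_u subnKC. Qed.

Let take_ext k u : size u = k -> take k (ext k u) = u.
Proof. by move=> sz_u; rewrite take_size_cat. Qed.

Let letter_ext k u : size u = k -> letter (ext k u) k = ord0.
Proof. by move=> sz_u; rewrite nth_cat sz_u ltnn subnn nth_nseq if_same. Qed.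

Lemma component_span e k f : (k < n)%N -> f \in component e k ->
  f = \sum_(t : k.-tuple 'I_d) ev f (ext k t) *: delta e k t.
Proof.
move=> lt_kn /componentP[q Eq]; apply: ev_inj => w sz_w; rewrite ev_sum.
have sz_t : size (take k w) == k by rewrite size_takel // sz_w ltnW.
rewrite (bigD1 (Tuple sz_t)) //= big1 => [|t neq].
  rewrite addr0 evZ ev_delta // eqxx !Eq ?size_ext ?(eqP sz_t) //.
  by rewrite letter_ext ?take_ext ?(eqP sz_t) // chi0 mul1r mulrC.
rewrite evZ ev_delta //; case: eqP => [E|]; last by rewrite mulr0.
by case/eqP: neq; apply: val_inj.
Qed.

Lemma component_dim e k : (k < n)%N -> has_dim (component e k) (d ^ k).
Proof.
move=> lt_kn; have -> : (d ^ k = #|{: k.-tuple 'I_d}|)%N.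
  by rewrite card_tuple card_ord.
apply: (@has_dim_basis _ _ _ _ (fun t : k.-tuple 'I_d => delta e k t)
  (fun (t : k.-tuple 'I_d) f => ev f (ext k t))).
- by move=> t; exact: delta_component.
- by move=> f; exact: component_span.
- move=> c t; rewrite ev_sum (bigD1 t) //= big1 => [|t' neq].
    rewrite addr0 evZ ev_delta ?size_ext ?size_tuple //.
    by rewrite take_ext ?size_tuple // eqxx letter_ext ?size_tuple // chi0 mulr1.
  rewrite evZ ev_delta ?size_ext ?size_tuple // take_ext ?size_tuple //.
  by rewrite (inj_eq val_inj) eq_sym (negPf neq) mulr0.
Qed.

(** The action is monomial in the basis [delta]: vertices of level [k] are permuted, with roots of
    unity as coefficients. *)
Lemma act_delta g e k u : (k < n)%N -> size u = k -> 
  rho g (delta e k u) = (chi e (cocycle (val g) u))^-1 *: delta e k (val g u).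
Proof.
move=> lt_kn sz_u; apply: ev_inj => w sz_w; rewrite evZ.
pose w' := val g^-1%g w.
have wE : w = val g w' by rewrite /w' -aut_mulE -valM mulgV.
have sz_w' : size w' = n by rewrite size_aut.
rewrite wE ev_act // !ev_delta ?size_aut // -aut_take.
rewrite (can_eq (aut_funK (val g))); case: eqP => [E|]; last by rewrite mulr0.
by rewrite chi_letter ?sz_w' // E mulrC mulfK // (chi_neq0 omega_prim).
Qed.

(* Only finitely many permutations of level [n] are induced by the stabilizer *)
(* of [x]; [f'] is the sum of the translates of [f] by them.                  *)
Lemma stabilizer_average (U : {pred V}) f (x : word d) :
  subrep rho U -> f \in U ->
  exists2 f', f' \in U &
    (forall g w, val g x = x -> size w = n -> ev f' (val g w) = ev f' w) /\
    exists (I : finType) (A : {set I}) (c : I -> genGroup S),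
      [/\ (0 < #|A|)%N, forall i, i \in A -> val (c i) x = x
        & forall w, size w = n -> ev f' w = \sum_(i in A) ev f (val (c i) w)].
Proof.
move=> sU fU; pose T := n.-tuple 'I_d.
pose induces (g : genGroup S) (s : {perm T}) := forall t, val (s t) = val g (val t).
have szT g (t : T) : size (val g (val t)) == n by rewrite size_aut size_tuple.
have act_inj g : injective (fun t : T => Tuple (szT g t) : T).
  by move=> t t' /(congr1 val)/= /(can_inj (aut_funK (val g)))/val_inj.
have ind_perm g : induces g (perm (@act_inj g)) by move=> t; rewrite permE.
pose A := [set s : {perm T} | `[< exists2 g : genGroup S, val g x = x & induces g s >]].
have AP s : reflect (exists2 g : genGroup S, val g x = x & induces g s) (s \in A).
  by rewrite inE; exact: asboolP.
have /boolp.choice[c cE] : forall s, exists g : genGroup S,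
    s \in A -> val g x = x /\ induces g s.
  move=> s; have [[g gx gs]|sA] := AP s; first by exists g.
  by exists 1%g.
exists (\sum_(s in A) rho (c s)^-1%g f).
  by apply: (subrep_sum _ sU) => s _; exact: sU.2.
have avgE w : size w = n ->
    ev (\sum_(s in A) rho (c s)^-1%g f) w = \sum_(s in A) ev f (val (c s) w).
  by move=> sz_w; rewrite ev_sum; apply: eq_bigr => s _; rewrite ev_actV ?invgK.
split; last first.
  exists {perm T}, A, c; split=> // [|s /cE[]//].
  apply/card_gt0P; exists (perm (@act_inj 1%g)); apply/AP.
  by exists 1%g; [rewrite val1 | exact: ind_perm].
move=> g w gx sz_w; rewrite !avgE ?size_aut //.
have sz_t : size w == n by rewrite sz_w.
pose t : T := Tuple sz_t; pose eta := perm (@act_inj g).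
have evE (t' : T) :
    \sum_(s in A) ev f (val (c s) (val t')) = \sum_(s in A) ev f (val (s t')).
  by apply: eq_bigr => s /cE[_ ->].
have -> : val g w = val (eta t) by rewrite ind_perm.
(* [A] is stable under multiplication by the permutation [eta] induced by [g], so the sum can be
   reindexed. *)
rewrite (evE (eta t)) (evE t) [RHS](reindex_inj (mulgI eta)).
apply: eq_big => s; last by rewrite permM.
apply/AP/AP => -[g' g'x gs].
- exists (g' * g)%g; first by rewrite valM aut_mulE gx.
  by move=> t'; rewrite permM gs ind_perm valM aut_mulE.
- exists (g' * g^-1)%g => [|t'].
    have gVx : val g^-1%g x = x by rewrite -{1}gx -aut_mulE -valM mulVg val1.
    by rewrite valM aut_mulE gVx.
  have := gs ((eta^-1)%g t'); rewrite permM permKV => ->.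
  rewrite valM aut_mulE -{2}[t'](permKV eta) ind_perm.
  by rewrite -[val g^-1%g _]aut_mulE -valM mulVg val1.
Qed.

Lemma component_prefix e k f w w' : (k < n)%N -> f \in component e k ->
  size w = n -> size w' = n -> take k.+1 w = take k.+1 w' -> ev f w = ev f w'.
Proof.
move=> lt_kn /componentP[q Eq] sz_w sz_w'.
by rewrite !take_letter ?sz_w ?sz_w' // => /rcons_inj[E1 E2]; rewrite !Eq // E1 E2.
Qed.

(** A nonzero [f] in [U] is averaged over the stabilizer of a vertex of level [k.+1] below [u]. The
    result is a nonzero multiple of [delta e k u], whose translates span the component. *)
Lemma component_irreducible e k : (k < n)%N -> (0 < e < d)%N ->
  irreducible_subrep rho (component e k).
Proof.
move=> lt_kn /andP[e_gt0 lt_ed]; have sW := component_subrep e lt_kn.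
have [_ homS homL] := S_hom.
split=> //.
  exists (delta e k (nseq k ord0)); first exact: delta_component.
  apply/eqP => /(congr1 (ev^~ (ext k (nseq k ord0)))).
  rewrite ev0 ev_delta ?size_ext ?size_nseq // take_ext ?size_nseq // eqxx.
  by rewrite letter_ext ?size_nseq // chi0 => /eqP; rewrite oner_eq0.
move=> U sU UW; have [|/existsNP[f]] := pselect (forall f, f \in U -> f = 0).
  by left.
move=> /not_implyP[fU f0]; right.
have [w [sz_w fw0]] : exists w, size w = n /\ ev f w != 0.
  apply: contrapT => nex; apply: f0; apply: ev_inj => w sz_w; rewrite ev0.
  by apply/eqP; apply: contrapT => fw0; apply: nex; exists w; split=> //; apply/negP.
pose u := take k w; have sz_u : size u = k by rewrite size_takel // sz_w ltnW.
have [f' f'U [f'inv [I [A [c [A0 cx f'E]]]]]] := stabilizer_average (take k.+1 w) sU fU.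
have f'W := UW f' f'U.
have f'w : ev f' w != 0.
  (* Every term equals [ev f w], since [f] depends only on the first [k.+1] letters and these are
     fixed; the number of terms is nonzero in characteristic 0. *)
  rewrite f'E // (eq_bigr (fun _ => ev f w)) => [|i iA].
    by rewrite sumr_const mulrn_eq0 negb_or -lt0n A0.
  apply: (component_prefix lt_kn (UW f fU)); rewrite ?size_aut //.
  by rewrite -aut_take cx.
have f'0 t : size t = n -> take k t != u -> ev f' t = 0.
  move=> sz_t neq; have sz_tk : size (take k t) = k by rewrite size_takel // sz_t ltnW.
  (* Choose [g] fixing the averaging vertex and rotating by one the children of the prefix of [t].
     Invariance then multiplies the value at [t] by [omega ^+ e], which differs from 1 as
     [0 < e < d]. *)
  have [||||g gG [gu gt]] := homS u (take k t)
    [:: letter w k] [:: letter t k] [:: ordS (letter t k)].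
  - by rewrite sz_u sz_tk.
  - by rewrite eq_sym.
  - by [].
  - by [].
  pose h : genGroup S := Sub g gG; have hg : val h = g by exact: SubK.
  rewrite !cats1 -take_letter ?sz_w // in gu.
  rewrite !cats1 -take_letter ?sz_t // in gt.
  have := f'inv h t; rewrite hg => /(_ gu sz_t).
  have /componentP[q Eq] := f'W; rewrite !Eq ?size_aut //.
  rewrite aut_take take_letter ?size_aut ?sz_t // in gt.
  have /rcons_inj[-> ->] := gt.
  rewrite (chi_ordS omega_prim) -mulrA; set z := (X in _ * X = X) => /eqP.
  rewrite -subr_eq0 -{2}[z]mul1r -mulrBl mulf_eq0 subr_eq0 => /orP[|/eqP//].
  by rewrite -(prim_order_dvd omega_prim) gtnNdvd.
have dU : delta e k u \in U.
  have /componentP[q Eq] := f'W.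
  have qu : q u != 0 by apply: contraNneq f'w => qu; rewrite Eq // -/u qu mulr0.
  suff -> : delta e k u = (q u)^-1 *: f' by exact: subrepZ sU f'U.
  apply: ev_inj => t sz_t; rewrite evZ ev_delta //; case: eqP => [E|/eqP neq].
    by rewrite Eq // E mulrC mulfK.
  by rewrite f'0 ?mulr0.
move=> h hW; rewrite (component_span lt_kn hW).
apply: (subrep_sum _ sU) => t _; apply: (subrepZ _ sU).
have [g gG gu] := homL u t (etrans sz_u (esym (size_tuple t))).
pose h' : genGroup S := Sub g gG; have hg : val h' = g by exact: SubK.
have := sU.2 h' _ dU; rewrite act_delta // hg gu => /(subrepZ (chi e (cocycle g u)) sU).
by rewrite scalerA mulfV ?scale1r // (chi_neq0 omega_prim).
Qed.

Local Notation index := (option ('I_d' * 'I_n)).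

Definition summand (i : index) : {pred V} :=
  if i is Some (e, k) then component e.+1 k else constants.

Definition summand_degree (i : index) : nat := if i is Some (_, k) then d ^ k else 1%N.

Lemma sum_index (W : nmodType) (x : index -> W) :
  \sum_i x i = x None + \sum_(k < n) \sum_(e < d') x (Some (e, k)).
Proof.
rewrite (bigD1 None) //=; congr (_ + _).
rewrite (reindex_omap Some id) /=; last by case.
rewrite exchange_big pair_big /=.
by apply: eq_big => [i|[]//]; rewrite eqxx.
Qed.

Lemma summand_exists f :
  exists2 x : index -> V, forall i, x i \in summand i & f = \sum_i x i.
Proof.
have [c [q E]] := fourier_exists omega_prim n (ev f).
exists (fun i : index => if i is Some (e, k)
  then lift (fun w => chi e.+1 (letter w k) * q e k (take k w))
  else lift (fun _ => c)).
  case=> [[e k]|] /=.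
    by apply/componentP; exists (q e k) => w sz_w; rewrite ev_lift.
  by apply/constantsP; exists c => w sz_w; rewrite ev_lift.
apply: ev_inj => w sz_w; rewrite sum_index evD ev_lift // E //; congr (_ + _).
rewrite ev_sum; apply: eq_bigr => k _; rewrite ev_sum; apply: eq_bigr => e _.
by rewrite ev_lift.
Qed.

Lemma summand_uniq (x : index -> V) : (forall i, x i \in summand i) ->
  \sum_i x i = 0 -> forall i, x i = 0.
Proof.
move=> xW x0.
have [c Ec] := constantsP _ (xW None).
have /boolp.choice[q Eq] : forall i : 'I_d' * 'I_n, exists q, forall w, size w = n ->
    ev (x (Some i)) w = chi i.1.+1 (letter w i.2) * q (take i.2 w).
  by case=> e k; exact: componentP _ _ _ (xW (Some (e, k))).
(* Coefficients indexed by ordinals are extended by zero to fit [fourier_uniq]. *)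
pose q' (e k : nat) (u : word d) :=
  if insub e is Some e' then if insub k is Some k' then q (e', k') u else 0 else 0.
have qE e k : q' (val e) (val k) = q (e, k).
  by apply: boolp.funext => u; rewrite /q' !valK.
have [w|c0 q0] := @fourier_uniq _ _ _ omega_prim n c q'.
  move=> sz_w; rewrite -(ev0 w) -x0 sum_index evD Ec //; congr (_ + _).
  rewrite ev_sum; apply: eq_bigr => k _; rewrite ev_sum; apply: eq_bigr => e _.
  by rewrite Eq // qE.
case=> [[e k]|]; apply: ev_inj => w sz_w; rewrite ev0 ?Ec //.
by rewrite Eq //= -qE q0 ?mulr0 ?ltn_ord // size_takel // sz_w ltnW.
Qed.

Lemma tree_decomposition degs :
  perm_eq (1%N :: flatten (nseq d' [seq (d ^ k)%N | k <- iota 0 n])) degs ->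
  irreducible_decomposition rho (n * d').+1 degs.
Proof.
move=> Edegs; apply: (@irreducible_decomposition_fin _ _ _ _ _ summand summand_degree).
- by rewrite card_option card_prod !card_ord mulnC.
- case=> [[e k]|] /=; last exact: constants_irreducible.
  by apply: component_irreducible; rewrite ?ltn_ord //= ltnS.
- exact: summand_exists.
- exact: summand_uniq.
- case=> [[e k]|] /=; [exact: component_dim | exact: constants_dim].
have powE : [seq (d ^ val k)%N | k <- enum 'I_n] = [seq (d ^ k)%N | k <- iota 0 n].
  by rewrite -val_enum_ord -map_comp.
apply: perm_trans Edegs; rewrite -powE.
rewrite (_ : nseq _ _ = [seq [seq (d ^ val k)%N | k <- enum 'I_n] | e <- enum 'I_d']);
  last by rewrite map_nseq_cst size_enum_ord.
rewrite (perm_trans (perm_map summand_degree (_ : perm_eq _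
  (None :: map Some [seq (e, k) | e <- enum 'I_d', k <- enum 'I_n])))) //.
  apply: uniq_perm; last first.
  - case=> [[e k]|]; rewrite mem_enum in_cons //=; apply/esym/mapP.
    by exists (e, k) => //; apply/allpairsP; exists (e, k); rewrite !mem_enum.
  - rewrite /= map_inj_uniq => [|? ? [] //]; apply/andP; split.
      by apply/mapP => -[].
    by apply: allpairs_uniq; rewrite ?enum_uniq // => -[? ?] [? ?].
  - exact: enum_uniq.
rewrite /= -map_comp map_allpairs.
by [].
Qed.

End TreeRepresentation.

(** * The quasi-regular representation *)

Section PrimitiveRoot.
Local Open Scope ring_scope.

(** Take a zero of [1 + z + ... + z^(p-1)]. Its order divides [p], and is not 1 because the sum at
    [z = 1] is [p], which is nonzero. *)
Lemma prime_prim_root (F : numClosedFieldType) p : prime p ->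
  exists z : F, p.-primitive_root z.
Proof.
case: p => [//|p] p_pr.
have p_gt0 : (0 < p)%N by rewrite -ltnS prime_gt1.
have [z Ez] := @solve_monicpoly F p (fun=> -1) p_gt0.
have sum0 : \sum_(i < p.+1) z ^+ i = 0.
  rewrite big_ord_recr /= Ez -big_split big1 //= => i _.
  by rewrite mulN1r subrr.
have zp : z ^+ p.+1 = 1 by apply/eqP; rewrite -subr_eq0 subrX1 sum0 mulr0.
exists z; have [m zm] := prim_order_exists (ltn0Sn p) zp.
move=> /(prime_nt_dvdP p_pr) => E; rewrite -E //.
apply: contraTneq isT => m1; have := prim_expr_order zm; rewrite m1 expr1 => z1.
move: sum0; rewrite z1; under eq_bigr do rewrite expr1n.
by rewrite sumr_const card_ord => /eqP; rewrite pnatr_eq0.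
Qed.

End PrimitiveRoot.

Section QuasiRegular.
Local Open Scope ring_scope.
Local Open Scope classical_set_scope.
Variables (R : realType) (d' n : nat).
Local Notation d := d'.+1.
Variable S : seq (treeAut d).
Hypothesis S_hom : cyclically_homogeneous S.
Variable v : word d.
Hypothesis sz_v : size v = n.
Local Notation G := (genGroup S).
Local Notation P := (vstab v : set G).
Local Notation X := (coset_space P).

Lemma lcoset_proof (g : G) : ltrans g P \in Defs.lcosets P.
Proof. by apply/mem_set; exists g. Qed.

Definition lcoset (g : G) : X := exist _ (ltrans g P) (lcoset_proof g).

Lemma lcoset_surj (C : X) : exists g, C = lcoset g.
Proof.
case: C => C CP; have /= [g _ E] := set_mem CP.
by exists g; apply: val_inj.
Qed.

Lemma lcosetP (g h : G) : lcoset g = lcoset h <-> val g v = val h v.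
Proof.
split=> E.
  have {}E : ltrans g P = ltrans h P := congr1 val E.
  have : ltrans h P g by rewrite -E; exists 1%g; rewrite ?mulg1.
  by case=> x xv <-; rewrite valM aut_mulE (xv : val x v = v).
have sub (x y : G) : val x v = val y v -> ltrans x P `<=` ltrans y P.
  move=> Exy _ [z zv <-]; exists (y^-1 * (x * z))%g; last by rewrite mulKVg.
  change (val (y^-1 * (x * z))%g v = v).
  by rewrite !valM !aut_mulE (zv : val z v = v) Exy -aut_mulE -valM mulVg.
by apply: val_inj; apply/seteqP; split; exact: sub.
Qed.

Lemma coset_act_lcoset (g h : G) : coset_act g (lcoset h) = lcoset (g * h)%g.
Proof. by apply: val_inj; rewrite /= ltransM. Qed.

(** The length condition sits inside the existential so that [word_coset] is total; on words of
    other lengths its value is irrelevant. *)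
Lemma rep_exists (w : word d) : exists g : G, size w = n -> val g v = w.
Proof.
have [sz_w|neq] := eqVneq (size w) n; last by exists 1%g => /eqP; rewrite (negPf neq).
have [_ _ homL] := S_hom; have [g gG gv] := homL v w (etrans sz_v (esym sz_w)).
by exists (Sub g gG); rewrite SubK.
Qed.

Definition word_coset (w : word d) : X := lcoset (projT1 (cid (rep_exists w))).

Lemma word_cosetE w (g : G) : size w = n -> val g v = w -> word_coset w = lcoset g.
Proof.
by rewrite /word_coset; case: cid => h /= hv /hv E gv; apply/lcosetP; rewrite E.
Qed.

Lemma coset_space_finite : finite_set [set: X].
Proof.
have -> : [set: X] = [set word_coset (val t) | t in [set: n.-tuple 'I_d]].
  apply/seteqP; split=> // C _; have [g ->] := lcoset_surj C.
  have sz_w : size (val g v) == n by rewrite size_aut sz_v.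
  by exists (Tuple sz_w) => //=; apply: word_cosetE; rewrite // (eqP sz_w).
exact/finite_image/finite_finset.
Qed.

Lemma all_square_summable (f : X -> R[i]^o) : f \in @square_summable R X.
Proof.
apply/square_summableP; rewrite esum_fset; last 2 first.
- exact: coset_space_finite.
- by move=> x _; rewrite lee_fin sqnorm_ge0.
by rewrite fsumEFin ?ltry //; exact: coset_space_finite.
Qed.

(** By orbit-stabilizer, cosets correspond to words of length [n]. There are finitely many, so every
    function is square summable and [tree_decomposition] applies with [ev] reading off values along
    this correspondence. *)
Lemma quasi_regular_decomposition degs : prime d ->
  perm_eq (1%N :: flatten (nseq d' [seq (d ^ k)%N | k <- iota 0 n])) degs ->
  irreducible_decomposition (quasi_regular R P) (n * d').+1 degs.
Proof.
move=> d_pr; have [omega omega_prim] := prime_prim_root R[i] d_pr.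
apply: (@tree_decomposition _ _ _ omega omega_prim S S_hom _ _
  (fun f w => val f (word_coset w))).
- by [].
- move=> f h E; apply: val_inj; apply: boolp.funext => C.
  have [g ->] := lcoset_surj C.
  have sz_w : size (val g v) = n by rewrite size_aut.
  by have := E _ sz_w; rewrite (word_cosetE sz_w erefl).
- move=> p.
  have /boolp.choice[r rE] : forall C : X, exists g, C = lcoset g by exact: lcoset_surj.
  exists (ell2_of (all_square_summable (fun C => p (val (r C) v)))) => w sz_w /=.
  congr p; have := rE (word_coset w); rewrite {1}/word_coset; case: cid => h /= hv.
  by move=> /lcosetP <-; exact: hv.
- move=> g f w sz_w /=; congr (val f _).
  have [h hv] := rep_exists w.
  rewrite (word_cosetE sz_w (hv sz_w)) (@word_cosetE _ (g * h)%g) ?size_aut //.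
    by rewrite coset_act_lcoset mulKg.
  by rewrite valM aut_mulE hv.
Qed.

End QuasiRegular.

(** * The concrete generators satisfy the criterion *)

Lemma aut2_locally_cyclic q : locally_cyclic (aut2 q).
Proof.
by apply: recAut_locally_cyclic; case; rewrite /= ?group1 ?cycle_id.
Qed.

Lemma aut3_locally_cyclic q : locally_cyclic (aut3 q).
Proof.
by apply: recAut_locally_cyclic; case; rewrite /= ?groupV ?group1 ?cycle_id.
Qed.

Lemma frakG_homogeneous : cyclically_homogeneous [:: aut2 A2; aut2 B2; aut2 C2; aut2 D2].
Proof.
apply: frakG_rec_homogeneous.
- move=> g; rewrite !(in_cons, in_nil, orbF).
  by move=> /or4P[] /eqP->; exact: aut2_locally_cyclic.
- by move=> i w; exact: aut2_aE.
- exact: (psi_b o20).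
- exact: (psi_b o21).
- exact: (psi_c o20).
- exact: (psi_c o21).
- exact: (psi_d o20).
- exact: (psi_d o21).
Qed.

Lemma frakGtilde_homogeneous :
  cyclically_homogeneous [:: aut2 A2; aut2 Bt2; aut2 Ct2; aut2 Dt2].
Proof.
apply: frakGtilde_rec_homogeneous.
- move=> g; rewrite !(in_cons, in_nil, orbF).
  by move=> /or4P[] /eqP->; exact: aut2_locally_cyclic.
- by move=> i w; exact: aut2_aE.
- exact: (psi_bt o20).
- exact: (psi_bt o21).
- exact: (psi_ct o20).
- exact: (psi_ct o21).
- exact: (psi_dt o20).
- exact: (psi_dt o21).
Qed.

Lemma aut3_pair_cyclic q q' g : g \in [:: aut3 q; aut3 q'] -> locally_cyclic g.
Proof.
by rewrite !(in_cons, in_nil, orbF) => /orP[] /eqP->; exact: aut3_locally_cyclic.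
Qed.

Lemma Gamma_homogeneous : cyclically_homogeneous [:: aut3 A3; aut3 R3].
Proof.
apply: Gamma_rec_homogeneous; first exact: aut3_pair_cyclic.
- by move=> i w; exact: aut3_aE.
- exact: (psi_r o32).
- exact: (psi_r o30).
- exact: (psi_r o31).
Qed.

Lemma Gambar_homogeneous : cyclically_homogeneous [:: aut3 A3; aut3 S3].
Proof.
apply: Gambar_rec_homogeneous; first exact: aut3_pair_cyclic.
- by move=> i w; exact: aut3_aE.
- exact: (psi_s o32).
- exact: (psi_s o30).
- exact: (psi_s o31).
Qed.

Lemma Gambarbar_homogeneous : cyclically_homogeneous [:: aut3 A3; aut3 T3].
Proof.
apply: Gambarbar_rec_homogeneous; first exact: aut3_pair_cyclic.
- by move=> i w; exact: aut3_aE.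
- exact: (psi_t o32).
- exact: (psi_t o30).
- exact: (psi_t o31).
Qed.

Theorem mainTheorem5 (R : realType) (n : nat) (hn : (1 <= n)%N) :
  (forall v : word 2, size v = n ->
     let degs := [:: 1; 1]%N ++ [seq (2 ^ i)%N | i <- index_iota 1 n] in
     irreducible_decomposition
       (quasi_regular R (vstab (d := 2) v : set frakG)) n.+1 degs /\
     irreducible_decomposition
       (quasi_regular R (vstab (d := 2) v : set frakGtilde)) n.+1 degs) /\
  (forall v : word 3, size v = n ->
     let degs := [:: 1; 1; 1]%N ++ [seq (3 ^ i)%N | i <- index_iota 1 n]
                                ++ [seq (3 ^ i)%N | i <- index_iota 1 n] in
     [/\ irreducible_decomposition
           (quasi_regular R (vstab (d := 3) v : set Gamma)) (2 * n + 1)%N degs,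
         irreducible_decomposition
           (quasi_regular R (vstab (d := 3) v : set Gambar)) (2 * n + 1)%N degs
       & irreducible_decomposition
           (quasi_regular R (vstab (d := 3) v : set Gambarbar)) (2 * n + 1)%N degs]).
Proof.
case: n hn => // m _; set n' := m.+1.
have iotaE p : [seq (p ^ k)%N | k <- iota 0 n'] =
    1%N :: [seq (p ^ i)%N | i <- index_iota 1 n'].
  by rewrite /index_iota subn1.
split=> v sz_v degs.
  have D : perm_eq (1%N :: flatten (nseq 1 [seq (2 ^ k)%N | k <- iota 0 n'])) degs.
    by rewrite iotaE /= cats0.
  rewrite -[n'.+1](congr1 _ (muln1 n')).
  by split; apply: quasi_regular_decomposition => //;
    [exact: frakG_homogeneous | exact: frakGtilde_homogeneous].
have D : perm_eq (1%N :: flatten (nseq 2 [seq (3 ^ k)%N | k <- iota 0 n'])) degs.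
  rewrite iotaE /degs /= cats0 !perm_cons.
  (* Moves the leading 1 of the second list of powers in front of the first. *)
  by rewrite perm_sym -cat1s perm_catCA /=.
rewrite addn1 mulnC.
by split; apply: quasi_regular_decomposition => //;
  [exact: Gamma_homogeneous | exact: Gambar_homogeneous | exact: Gambarbar_homogeneous].
Qed.
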